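(* The following are equivalent over $\mathsf{RCA}_0$: (i) No finite collection $(x_n)_{n\leq N}$ of reals is dense in the order $\mathbb R$, i.e., for any such collection there are reals $y<z$ such that $y\leq x_n\leq z$ fails for all $n\leq N$. (ii) The $\Sigma^0_2$-cardinality principle $\mathsf C\Sigma^0_2$ holds.
   Context: $\mathsf{RCA}_0$ is the usual base system of second-order arithmetic (basic arithmetic axioms, $\Sigma^0_1$-induction, $\Delta^0_1$-comprehension). ''Equivalent over $\mathsf{RCA}_0$'' means that the equivalence, formalized in second-order arithmetic, is provable in $\mathsf{RCA}_0$. Reals. A real is a Cauchy sequence $x=(x_n)_{n\in\mathbb N}$ of rationals with no rate of convergence given: for each rational $\varepsilon>0$ there is an $N\in\mathbb N$ with $|x_m-x_n|<\varepsilon$ for all $m,n\geq N$. For reals $x,y$: $x\leq y$ means that for each rational $\varepsilon>0$ there is an $N$ with $x_n\leq y_n+\varepsilon$ for all $n\geq N$; $x=y$ means $x\leq y$ and $y\leq x$; $x<y$ means $x\leq y$ but not $x=y$. A finite collection $(x_n)_{n\leq N}$ of reals is a family of rationals $(x_{ni})_{n\leq N,i\in\mathbb N}$ (coded as one set) such that $x_n=(x_{ni})_{i\in\mathbb N}$ is a real for each $n\leq N$; no uniformity in $n$ is required. $\mathsf C\Sigma^0_2$: for no $N\in\mathbb N$ is there a $\Sigma^0_2$-definable injection $C\colon\mathbb N\to\{0,\ldots,N\}$. Here $C$ is not given as a set; one quantifies over $\Sigma^0_2$-formulas (with parameters) that define graphs of injective functions, via a partial truth definition for $\Sigma^0_2$-formulas.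 *)

(* Defs.v *)
From Stdlib Require Import List.
Import ListNotations.

(** * Second-order arithmetic: language, deduction, RCA_0

    Number variables and set variables are de Bruijn indices, counted
    separately.  The connectives not listed below are the classical
    abbreviations.  Equality of sets is not primitive. *)

Inductive term : Type :=
| TVar (k : nat)
| TZero
| TOne
| TAdd (t u : term)
| TMul (t u : term).

Inductive form : Type :=
| FBot
| FEq (t u : term)
| FLt (t u : term)
| FMem (t : term) (X : nat)
| FImp (p q : form)
| FAll (p : form)
| FAllS (p : form).

Definition FNeg p := FImp p FBot.
Definition FAnd p q := FNeg (FImp p (FNeg q)).
Definition FOr p q := FImp (FNeg p) q.
Definition FIff p q := FAnd (FImp p q) (FImp q p).
Definition FEx p := FNeg (FAll (FNeg p)).
Definition FExS p := FNeg (FAllS (FNeg p)).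

Fixpoint subst_term (sigma : nat -> term) (t : term) : term :=
  match t with
  | TVar k => sigma k
  | TZero => TZero
  | TOne => TOne
  | TAdd t u => TAdd (subst_term sigma t) (subst_term sigma u)
  | TMul t u => TMul (subst_term sigma t) (subst_term sigma u)
  end.

Definition lift_term : term -> term := subst_term (fun k => TVar (S k)).

Definition up (sigma : nat -> term) (k : nat) : term :=
  match k with 0 => TVar 0 | S k => lift_term (sigma k) end.

Definition upS (rho : nat -> nat) (k : nat) : nat :=
  match k with 0 => 0 | S k => S (rho k) end.

(** Simultaneous substitution of terms for number variables and of set
    variables for set variables. *)
Fixpoint subst (sigma : nat -> term) (rho : nat -> nat) (p : form) : form :=
  match p with
  | FBot => FBot
  | FEq t u => FEq (subst_term sigma t) (subst_term sigma u)
  | FLt t u => FLt (subst_term sigma t) (subst_term sigma u)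
  | FMem t X => FMem (subst_term sigma t) (rho X)
  | FImp p q => FImp (subst sigma rho p) (subst sigma rho q)
  | FAll p => FAll (subst (up sigma) rho p)
  | FAllS p => FAllS (subst sigma (upS rho) p)
  end.

Definition id_set (k : nat) : nat := k.

Definition lift : form -> form := subst (fun k => TVar (S k)) id_set.
Definition liftS : form -> form := subst TVar S.

Definition inst (t : term) : form -> form :=
  subst (fun k => match k with 0 => t | S k => TVar k end) id_set.
Definition instS (X : nat) : form -> form :=
  subst TVar (fun k => match k with 0 => X | S k => k end).

(** Two-sorted classical natural deduction with equality for numbers.  The
    axioms in [T] may have free variables; as [prv_ax] is available in every
    context [G], these are read as universally quantified (parameters). *)
Inductive prv (T : form -> Prop) : list form -> form -> Prop :=
| prv_ax G p : T p -> prv T G p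
| prv_hyp G p : In p G -> prv T G p
| prv_impI G p q : prv T (p :: G) q -> prv T G (FImp p q)
| prv_impE G p q : prv T G (FImp p q) -> prv T G p -> prv T G q
| prv_raa G p : prv T (FNeg p :: G) FBot -> prv T G p
| prv_allI G p : prv T (map lift G) p -> prv T G (FAll p)
| prv_allE G p t : prv T G (FAll p) -> prv T G (inst t p)
| prv_allSI G p : prv T (map liftS G) p -> prv T G (FAllS p)
| prv_allSE G p X : prv T G (FAllS p) -> prv T G (instS X p)
| prv_refl G t : prv T G (FEq t t)
| prv_leibniz G t u p :
    prv T G (FEq t u) -> prv T G (inst t p) -> prv T G (inst u p).

Definition provable (T : form -> Prop) (p : form) : Prop := prv T [] p.

(** Formulas whose only quantifiers are bounded number quantifiers.  Bounded
    existential quantifiers are covered as the duals of the universal ones;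
    the bounding term does not contain the bound variable. *)
Inductive delta0 : form -> Prop :=
| delta0_bot : delta0 FBot
| delta0_eq t u : delta0 (FEq t u)
| delta0_lt t u : delta0 (FLt t u)
| delta0_mem t X : delta0 (FMem t X)
| delta0_imp p q : delta0 p -> delta0 q -> delta0 (FImp p q)
| delta0_ball t p :
    delta0 p -> delta0 (FAll (FImp (FLt (TVar 0) (lift_term t)) p)).

Definition sigma1 (p : form) : Prop := exists q, delta0 q /\ p = FEx q.
Definition pi1 (p : form) : Prop := exists q, delta0 q /\ p = FAll q.

(** ** Concrete formulas

    Concrete terms and formulas are written with Rocq-level binders: a [tm] is
    a term waiting for the number of enclosing number quantifiers, a [fm] is a
    formula waiting for the numbers of enclosing number and set quantifiers.
    A bound variable is thus represented by its level. *)

Definition tm := nat -> term.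
Definition st := nat -> nat.
Definition fm := nat -> nat -> form.

Definition tzero : tm := fun _ => TZero.
Definition tone : tm := fun _ => TOne.
Definition tadd (t u : tm) : tm := fun d => TAdd (t d) (u d).
Definition tmul (t u : tm) : tm := fun d => TMul (t d) (u d).

Definition fbot : fm := fun _ _ => FBot.
Definition feq (t u : tm) : fm := fun d _ => FEq (t d) (u d).
Definition flt (t u : tm) : fm := fun d _ => FLt (t d) (u d).
Definition fmem (t : tm) (X : st) : fm := fun d e => FMem (t d) (X e).
Definition fneg (p : fm) : fm := fun d e => FNeg (p d e).
Definition fimp (p q : fm) : fm := fun d e => FImp (p d e) (q d e).
Definition fand (p q : fm) : fm := fun d e => FAnd (p d e) (q d e).
Definition for_ (p q : fm) : fm := fun d e => FOr (p d e) (q d e).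
Definition fiff (p q : fm) : fm := fun d e => FIff (p d e) (q d e).

Definition fall (f : tm -> fm) : fm :=
  fun d e => FAll (f (fun d' => TVar (d' - S d)) (S d) e).
Definition fex (f : tm -> fm) : fm :=
  fun d e => FEx (f (fun d' => TVar (d' - S d)) (S d) e).
Definition fallS (f : st -> fm) : fm :=
  fun d e => FAllS (f (fun e' => e' - S e) d (S e)).
Definition fexS (f : st -> fm) : fm :=
  fun d e => FExS (f (fun e' => e' - S e) d (S e)).

Definition sentence (p : fm) : form := p 0 0.

Declare Scope fm_scope.
Delimit Scope fm_scope with fm.
Notation "0" := tzero : fm_scope.
Notation "1" := tone : fm_scope.
Notation "t + u" := (tadd t u) : fm_scope.
Notation "t * u" := (tmul t u) : fm_scope.
Notation "t = u" := (feq t u) : fm_scope.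
Notation "t < u" := (flt t u) : fm_scope.
Notation "t <= u" := (for_ (flt t u) (feq t u)) : fm_scope.
Notation "t '∈' X" := (fmem t X) (at level 70) : fm_scope.
Notation "~ p" := (fneg p) : fm_scope.
Notation "p /\ q" := (fand p q) : fm_scope.
Notation "p \/ q" := (for_ p q) : fm_scope.
Notation "p <-> q" := (fiff p q) : fm_scope.
Notation "p ⇒ q" := (fimp p q) (at level 97, right associativity) : fm_scope.
Notation "'∀' x .. y , p" := (fall (fun x => .. (fall (fun y => p)) ..))
  (at level 200, x binder, y binder, right associativity) : fm_scope.
Notation "'∃' x .. y , p" := (fex (fun x => .. (fex (fun y => p)) ..))
  (at level 200, x binder, y binder, right associativity) : fm_scope.
Notation "'∀S' x .. y , p" := (fallS (fun x => .. (fallS (fun y => p)) ..))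
  (at level 200, x binder, y binder, right associativity) : fm_scope.
Notation "'∃S' x .. y , p" := (fexS (fun x => .. (fexS (fun y => p)) ..))
  (at level 200, x binder, y binder, right associativity) : fm_scope.
Notation "'∀[' x < t ] p" := (fall (fun x => fimp (flt x t) p))
  (at level 200, x name, t at level 69, p at level 200) : fm_scope.
Notation "'∃[' x < t ] p" := (fneg (fall (fun x => fimp (flt x t) (fneg p))))
  (at level 200, x name, t at level 69, p at level 200) : fm_scope.
Local Open Scope fm_scope.

(** ** RCA_0 *)

Definition basic_axioms : list form := map sentence
  [ ∀ n, ~ (n + 1 = 0);
    ∀ m n, m + 1 = n + 1 ⇒ m = n;
    ∀ m, m + 0 = m;
    ∀ m n, m + (n + 1) = (m + n) + 1;
    ∀ m, m * 0 = 0;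
    ∀ m n, m * (n + 1) = (m * n) + m;
    ∀ m, ~ (m < 0);
    ∀ m n, m < n + 1 <-> (m < n \/ m = n) ].

Definition induction (p : form) : form :=
  FImp (inst TZero p)
    (FImp (FAll (FImp p
            (subst (fun k => match k with
                             | O => TAdd (TVar O) TOne
                             | S k => TVar (S k)
                             end) id_set p)))
       (FAll p)).

(** [liftS] ensures that the set asserted to exist is not free in [p]. *)
Definition comprehension (p q : form) : form :=
  FImp (FAll (FIff p q)) (FExS (FAll (FIff (FMem (TVar O) O) (liftS p)))).

Inductive RCA0 : form -> Prop :=
| RCA0_basic p : In p basic_axioms -> RCA0 p
| RCA0_sigma1_induction p : sigma1 p -> RCA0 (induction p)
| RCA0_delta1_comprehension p q :
    sigma1 p -> pi1 q -> RCA0 (comprehension p q).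

(** * Reals *)

Definition pr (x y : tm) : tm := (x + y) * (x + y) + x.
Notation "⟨ x , .. , y , z ⟩" := (pr x .. (pr y z) ..) : fm_scope.

(** [Rat p n d] stands for the rational (p - n) / (d + 1), which is coded by
    the number ⟨p, n, d⟩.  A rational has several codes; equality and order of
    rationals are relations on codes. *)
Record rat : Type := Rat { rpos : tm; rneg : tm; rden : tm }.

Definition rcode (a : rat) : tm := ⟨rpos a, rneg a, rden a⟩.
Definition rdenom (a : rat) : tm := rden a + 1.

Definition rzero : rat := Rat 0 0 0.
Definition radd (a b : rat) : rat :=
  Rat (rpos a * rdenom b + rpos b * rdenom a)
      (rneg a * rdenom b + rneg b * rdenom a)
      (rden a * rden b + rden a + rden b).
Definition rlt (a b : rat) : fm :=
  rpos a * rdenom b + rneg b * rdenom a < rpos b * rdenom a + rneg a * rdenom b.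
Definition rle (a b : rat) : fm :=
  rpos a * rdenom b + rneg b * rdenom a <= rpos b * rdenom a + rneg a * rdenom b.

(** |a - b| < e *)
Definition rclose (a b e : rat) : fm := rlt a (radd b e) /\ rlt b (radd a e).

Definition rall (f : rat -> fm) : fm := ∀ p n d, f (Rat p n d).
Definition rex (f : rat -> fm) : fm := ∃ p n d, f (Rat p n d).

(** A sequence of rationals is given by the relation "the [i]-th entry is the
    rational with code [rcode a]".  This covers both a sequence that is a set
    and a member of a family that is coded as one set. *)
Definition rseq := tm -> rat -> fm.

Definition seq_of_set (X : st) : rseq := fun i a => ⟨i, rcode a⟩ ∈ X.
Definition seq_of_family (X : st) (n : tm) : rseq :=
  fun i a => ⟨⟨n, i⟩, rcode a⟩ ∈ X.

Definition is_seq (x : rseq) : fm :=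
  ∀ i, rex (x i)
       /\ rall (fun a => rall (fun b => x i a /\ x i b ⇒ rcode a = rcode b)).

Definition rpositive (e : rat) : fm := rlt rzero e.

Definition cauchy (x : rseq) : fm :=
  rall (fun e => rpositive e ⇒
    ∃ N, ∀ m n, N <= m /\ N <= n ⇒
      rall (fun a => rall (fun b => x m a /\ x n b ⇒ rclose a b e))).

Definition real_seq (x : rseq) : fm := is_seq x /\ cauchy x.

Definition real (X : st) : fm :=
  (∀ z, z ∈ X ⇒ ∃ i, rex (fun a => z = ⟨i, rcode a⟩))
  /\ real_seq (seq_of_set X).

Definition finite_collection (N : tm) (X : st) : fm :=
  (∀ z, z ∈ X ⇒ ∃ n i, n <= N /\ rex (fun a => z = ⟨⟨n, i⟩, rcode a⟩))
  /\ (∀ n, n <= N ⇒ real_seq (seq_of_family X n)).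

Definition real_le (x y : rseq) : fm :=
  rall (fun e => rpositive e ⇒
    ∃ N, ∀ n, N <= n ⇒
      rall (fun a => rall (fun b => x n a /\ y n b ⇒ rle a (radd b e)))).
Definition real_eq (x y : rseq) : fm := real_le x y /\ real_le y x.
Definition real_lt (x y : rseq) : fm := real_le x y /\ ~ real_eq x y.

Definition no_dense_finite_collection : form := sentence
  (∀ N, ∀S X, finite_collection N X ⇒
    ∃S Y Z, real Y /\ real Z /\ real_lt (seq_of_set Y) (seq_of_set Z)
      /\ ∀ n, n <= N ⇒
           ~ (real_le (seq_of_set Y) (seq_of_family X n)
              /\ real_le (seq_of_family X n) (seq_of_set Z))).

(** * Partial truth definition for Sigma^0_2-formulas *)

Fixpoint num (n : nat) : tm :=
  match n with O => 0 | S n => num n + 1 end.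
Notation "# n" := (num n) (at level 0, n constr at level 0) : fm_scope.

(** The triple (B, m, n) codes the finite set of all i < B such that
    m * (i + 1) + 1 divides n.  Every finite set has such a code. *)
Record finset : Type := FinSet { fbound : tm; fmod : tm; fnum : tm }.

Definition fin_mem (z : tm) (w : finset) : fm :=
  z < fbound w
  /\ ∃[ c < fnum w + 1 ] (fmod w * (z + 1) + 1) * c = fnum w.

(** Codes of terms:
      ⟨#0, k⟩      the k-th variable (de Bruijn)
      ⟨#1, #0⟩     0
      ⟨#2, #0⟩     1
      ⟨#3, u, v⟩   u + v
      ⟨#4, u, v⟩   u * v
    Codes of Delta^0_0-formulas:
      ⟨#0, #0⟩     falsity
      ⟨#1, u, v⟩   u = v
      ⟨#2, u, v⟩   u < v
      ⟨#3, j, u⟩   u is an element of the j-th set parameter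
      ⟨#4, p, q⟩   p -> q
      ⟨#5, u, p⟩   for all x < u, p, where x is the variable 0 of p
                   and u is outside the scope of the quantifier *)

(** Every element ⟨#0, t⟩ of [w] is the term t, every element ⟨#1, p⟩ the
    formula p, formed from other elements of [w]. *)
Definition formation (w : finset) : fm :=
  let B := fbound w in
  (∀[ t < B ] fin_mem ⟨#0, t⟩ w ⇒
       t = ⟨#1, #0⟩ \/ t = ⟨#2, #0⟩
       \/ (∃[ k < B ] t = ⟨#0, k⟩)
       \/ (∃[ u < B ] ∃[ v < B ]
             fin_mem ⟨#0, u⟩ w /\ fin_mem ⟨#0, v⟩ w
             /\ (t = ⟨#3, u, v⟩ \/ t = ⟨#4, u, v⟩)))
  /\ (∀[ p < B ] fin_mem ⟨#1, p⟩ w ⇒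
       p = ⟨#0, #0⟩
       \/ (∃[ u < B ] ∃[ v < B ]
             fin_mem ⟨#0, u⟩ w /\ fin_mem ⟨#0, v⟩ w
             /\ (p = ⟨#1, u, v⟩ \/ p = ⟨#2, u, v⟩))
       \/ (∃[ j < B ] ∃[ u < B ]
             fin_mem ⟨#0, u⟩ w /\ p = ⟨#3, j, u⟩)
       \/ (∃[ q < B ] ∃[ r < B ]
             fin_mem ⟨#1, q⟩ w /\ fin_mem ⟨#1, r⟩ w /\ p = ⟨#4, q, r⟩)
       \/ (∃[ u < B ] ∃[ q < B ]
             fin_mem ⟨#0, u⟩ w /\ fin_mem ⟨#1, q⟩ w /\ p = ⟨#5, u, q⟩)).

Definition is_delta0_code (p : tm) : fm :=
  ∃ B m n, let w := FinSet B m n in formation w /\ fin_mem ⟨#1, p⟩ w.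

(** An assignment s = ⟨x_0, ⟨x_1, ...⟩⟩ gives the value x_k to variable k.
    A number that is not a pair is read like 0 = ⟨0, 0⟩, which gives all
    variables the value 0; so any number is an assignment.  [uncons s x r]: the
    value of variable 0 under [s] is [x], those of the others are given by [r]. *)
Definition uncons (s x r : tm) : fm :=
  s = ⟨x, r⟩
  \/ (x = 0 /\ r = 0 /\ ~ (∃[ a < s + 1 ] ∃[ b < s + 1 ] s = ⟨a, b⟩)).

Definition term_entry (t s y : tm) : tm := ⟨#0, t, s, y⟩.
Definition form_entry (p s b : tm) : tm := ⟨#1, p, s, b⟩.

(** [b] is the truth value (1 or 0) of [P] *)
Definition truth_value (b : tm) (P : fm) : fm :=
  (b = 1 /\ P) \/ (b = 0 /\ ~ P).

(** [w] is a partial evaluation relative to the set parameters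
    X_j = {x | ⟨j, x⟩ ∈ X}: if [term_entry t s y] (or [form_entry p s b]) is in
    [w], then Tarski's clause yields the value [y] of [t] (the truth value [b]
    of [p]) under the assignment [s] from other entries in [w]. *)
Definition evaluation (w : finset) (X : st) : fm :=
  let B := fbound w in
  (∀[ t < B ] ∀[ s < B ] ∀[ y < B ] fin_mem (term_entry t s y) w ⇒
       (∃[ x < s + 1 ] ∃[ r < s + 1 ] uncons s x r
           /\ ((t = ⟨#0, #0⟩ /\ y = x)
               \/ ∃[ k < B ] t = ⟨#0, k + 1⟩
                             /\ fin_mem (term_entry ⟨#0, k⟩ r y) w))
       \/ (t = ⟨#1, #0⟩ /\ y = 0)
       \/ (t = ⟨#2, #0⟩ /\ y = 1)
       \/ (∃[ u < B ] ∃[ v < B ] ∃[ a < B ] ∃[ b < B ]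
             fin_mem (term_entry u s a) w /\ fin_mem (term_entry v s b) w
             /\ ((t = ⟨#3, u, v⟩ /\ y = a + b)
                 \/ (t = ⟨#4, u, v⟩ /\ y = a * b))))
  /\ (∀[ p < B ] ∀[ s < B ] ∀[ b < B ] fin_mem (form_entry p s b) w ⇒
       (p = ⟨#0, #0⟩ /\ truth_value b fbot)
       \/ (∃[ u < B ] ∃[ v < B ] ∃[ x < B ] ∃[ y < B ]
             fin_mem (term_entry u s x) w /\ fin_mem (term_entry v s y) w
             /\ ((p = ⟨#1, u, v⟩ /\ truth_value b (x = y))
                 \/ (p = ⟨#2, u, v⟩ /\ truth_value b (x < y))))
       \/ (∃[ j < B ] ∃[ u < B ] ∃[ x < B ]
             fin_mem (term_entry u s x) w
             /\ p = ⟨#3, j, u⟩ /\ truth_value b (⟨j, x⟩ ∈ X))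
       \/ (∃[ q < B ] ∃[ r < B ] ∃[ c < B ] ∃[ d < B ]
             fin_mem (form_entry q s c) w /\ fin_mem (form_entry r s d) w
             /\ p = ⟨#4, q, r⟩ /\ truth_value b (c = 1 ⇒ d = 1))
       \/ (∃[ u < B ] ∃[ q < B ] ∃[ y < B ]
             fin_mem (term_entry u s y) w /\ p = ⟨#5, u, q⟩
             /\ ((b = 1 /\ ∀[ x < y ] fin_mem (form_entry q ⟨x, s⟩ 1) w)
                 \/ (b = 0 /\ ∃[ x < y ] fin_mem (form_entry q ⟨x, s⟩ 0) w)))).

(** Truth of Delta^0_0-formulas is Delta^0_1 in RCA_0; the Pi^0_1 version makes
    [true_sigma2] a Sigma^0_2-formula. *)
Definition true_delta0 (p s : tm) (X : st) : fm :=
  ∀ B m n, let w := FinSet B m n in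
    evaluation w X ⇒ ∀[ b < B ] fin_mem (form_entry p s b) w ⇒ b = 1.

(** The Sigma^0_2-formula "there is an x such that p for all y" with p in
    Delta^0_0 is represented by the code of p, in which the variables y and x
    have indices 0 and 1. *)
Definition true_sigma2 (p s : tm) (X : st) : fm :=
  ∃ x, ∀ y, true_delta0 p ⟨y, x, s⟩ X.

(** * The Sigma^0_2-cardinality principle *)

(** [C] is the graph of an injection from all numbers to {0, ..., N}. *)
Definition injection_into (N : tm) (C : tm -> tm -> fm) : fm :=
  (∀ i, ∃ j, C i j)
  /\ (∀ i j, C i j ⇒ j <= N)
  /\ (∀ i j k, C i j /\ C i k ⇒ j = k)
  /\ (∀ i j k, C i k /\ C j k ⇒ i = j).

(** [p] ranges over Sigma^0_2-formulas, [v] and [X] over assignments for the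
    number and set parameters. *)
Definition sigma2_cardinality_principle : form := sentence
  (~ ∃ N, ∃ p v, ∃S X,
     is_delta0_code p
     /\ injection_into N (fun i j => true_sigma2 p ⟨i, j, v⟩ X)).

(* Main.v *)
(** By completeness of the calculus it suffices to argue in an arbitrary, possibly
    nonstandard model of RCA_0.

    Given a Sigma^0_2-injection C into {0, ..., N}, call w = ⟨j, x⟩ a witness
    for m if x shows C(m) = j, which is a Pi^0_1-property.  The least witnesses
    for m <= N + 1 are unbounded: a bound would yield a code for the restriction
    of C to {0, ..., N + 1}, against the pigeonhole principle for coded
    relations, which can be proved by bounded induction.  Consider the least w
    that is a witness for m or has the form ⟨i, x⟩ with x showing C(i) = n.  It
    exists as C is total, and its approximations, obtained by waiting for
    refutations, become stable.  So the rationals coded by the first components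
    of these approximations form an eventually constant sequence.  For n = C(i),
    its value is the rational coded by i once m has no small witness.  As i is
    arbitrary, these finitely many reals are dense.

    Conversely, if (x_n) is dense, then each interval [3m + 1, 3m + 2] contains
    some x_n, which ultimately stays in (3m, 3m + 3) by a Sigma^0_2-property.
    For fixed n this determines m.  Choosing n by the least witness makes the
    relation functional. *)

From Stdlib Require Import List Arith Lia Cantor.
From Stdlib Require Import Classical ClassicalEpsilon FunctionalExtensionality
  PropExtensionality ProofIrrelevance.
From Stdlib Require Import ssreflect Ring.
Require Import Defs.
Import ListNotations.

Set Implicit Arguments.
Unset Strict Implicit.
Unset Printing Implicit Defensive.

(** The family has to be fixed before any interval is known, and C need not be surjective: for n
    outside its range, a search for some i with C(i) = n never ends and gives no Cauchy sequence.
    The competing search for a witness for m, which succeeds for every m, repairs this. It must lose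
    whenever n = C(i), for arbitrary i; hence m ranges over N + 2 arguments, one more than there are
    possible values, as the pigeonhole principle demands.

    Limits of approximations and least witnesses therefore come from a least number principle for
    Pi_1-properties which also delivers one bound on the refutations of all smaller numbers;
    Sigma_1-induction proves it.

    A model may contain nonstandard codes of formulas. In the first direction the truth definition
    enters only through its Pi_1 form. In the second, comprehension absorbs the Delta_0 matrix into
    the set parameter, so that a single standard atomic formula has to be evaluated. *)

Definition scons A (a : A) (f : nat -> A) (k : nat) : A :=
  match k with O => a | S k => f k end.
Infix ".:" := scons (at level 55, right associativity).

(** * Substitution *)

Lemma subst_term_comp s r t :
  subst_term s (subst_term r t) = subst_term (fun k => subst_term s (r k)) t.
Proof. by elim: t => //= t -> u ->. Qed.

Lemma subst_term_id t : subst_term TVar t = t.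
Proof. by elim: t => //= t -> u ->. Qed.

Lemma up_lift s t : subst_term (up s) (lift_term t) = lift_term (subst_term s t).
Proof. by rewrite /lift_term !subst_term_comp. Qed.

Lemma up_comp s r :
  (fun k => subst_term (up s) (up r k)) = up (fun k => subst_term s (r k)).
Proof. by apply: functional_extensionality => -[//|k]; apply: up_lift. Qed.

Lemma up_id : up TVar = TVar.
Proof. by apply: functional_extensionality => -[]. Qed.

Lemma upS_comp s r : (fun k => upS s (upS r k)) = upS (fun k => s (r k)).
Proof. by apply: functional_extensionality => -[]. Qed.

Lemma upS_id : upS id_set = id_set.
Proof. by apply: functional_extensionality => -[]. Qed.

Lemma subst_comp s z r y p :
  subst s z (subst r y p)
  = subst (fun k => subst_term s (r k)) (fun k => z (y k)) p.
Proof.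
elim: p s z r y => //=.
- by move=> t u *; rewrite !subst_term_comp.
- by move=> t u *; rewrite !subst_term_comp.
- by move=> t X *; rewrite !subst_term_comp.
- by move=> p IHp q IHq *; rewrite IHp IHq.
- by move=> p IH *; rewrite IH up_comp.
- by move=> p IH *; rewrite IH upS_comp.
Qed.

Lemma subst_id p : subst TVar id_set p = p.
Proof.
elim: p => //=.
- by move=> t u; rewrite !subst_term_id.
- by move=> t u; rewrite !subst_term_id.
- by move=> t X; rewrite !subst_term_id.
- by move=> p -> q ->.
- by move=> p IH; rewrite up_id IH.
- by move=> p IH; rewrite upS_id IH.
Qed.

Lemma inst_eq t p : inst t p = subst (t .: TVar) id_set p.
Proof. by []. Qed.

Lemma inst_up t s z p : inst t (subst (up s) z p) = subst (t .: s) z p.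
Proof.
rewrite inst_eq subst_comp; congr (subst _ _ p).
by apply: functional_extensionality => -[//|k] /=;
  rewrite /lift_term subst_term_comp subst_term_id.
Qed.

Lemma instS_up X s z p : instS X (subst s (upS z) p) = subst s (X .: z) p.
Proof.
rewrite /instS subst_comp; congr (subst _ _ p).
  by apply: functional_extensionality => k; apply: subst_term_id.
by apply: functional_extensionality => -[].
Qed.

Lemma subst_inst t s z p :
  subst s z (inst t p) = inst (subst_term s t) (subst (up s) z p).
Proof.
rewrite inst_up inst_eq subst_comp; congr (subst _ _ p).
by apply: functional_extensionality => -[].
Qed.

Lemma subst_instS X s z p :
  subst s z (instS X p) = instS (z X) (subst s (upS z) p).
Proof.
rewrite instS_up /instS subst_comp; congr (subst _ _ p).
by apply: functional_extensionality => -[].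
Qed.

Lemma subst_lift s z p : subst (up s) z (lift p) = lift (subst s z p).
Proof. by rewrite /lift !subst_comp. Qed.

Lemma subst_liftS s z p : subst s (upS z) (liftS p) = liftS (subst s z p).
Proof.
rewrite /liftS !subst_comp; congr (subst _ _ p).
by apply: functional_extensionality => k; rewrite /= subst_term_id.
Qed.

(** * Quotients *)

Section Quotient.
Variables (A : Type) (R : A -> A -> Prop).
Hypothesis R_refl : forall a, R a a.
Hypothesis R_sym : forall a b, R a b -> R b a.
Hypothesis R_trans : forall a b c, R a b -> R b c -> R a c.

Definition quot := {c : A -> Prop | exists a, c = R a}.
Definition cls a : quot := exist _ (R a) (ex_intro _ a eq_refl).
Definition rep (c : quot) : A :=
  proj1_sig (constructive_indefinite_description _ (proj2_sig c)).

Lemma cls_eq a b : cls a = cls b <-> R a b.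
Proof.
split=> [[E]|E]; first by rewrite E; apply: R_refl.
apply: subset_eq_compat; apply: functional_extensionality => c.
apply: propositional_extensionality.
by split; apply: R_trans => //; apply: R_sym.
Qed.

Lemma cls_rep c : cls (rep c) = c.
Proof.
rewrite /rep; case: constructive_indefinite_description => a /= E.
by case: c E => c Hc /= E; apply: subset_eq_compat.
Qed.

Lemma rep_cls a : R (rep (cls a)) a.
Proof. by apply/cls_eq; apply: cls_rep. Qed.

End Quotient.

(** * Models *)

Record model := Model {
  dom :> Type; sets : Type;
  m0 : dom; m1 : dom; madd : dom -> dom -> dom; mmul : dom -> dom -> dom;
  mlt : dom -> dom -> Prop; mmem : dom -> sets -> Prop }.

Section Semantics.
Variable M : model.

Fixpoint eval (v : nat -> M) (t : term) : M :=
  match t with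
  | TVar k => v k
  | TZero => m0 M
  | TOne => m1 M
  | TAdd t u => madd (eval v t) (eval v u)
  | TMul t u => mmul (eval v t) (eval v u)
  end.

Fixpoint sat (v : nat -> M) (V : nat -> sets M) (p : form) : Prop :=
  match p with
  | FBot => False
  | FEq t u => eval v t = eval v u
  | FLt t u => mlt (eval v t) (eval v u)
  | FMem t X => mmem (eval v t) (V X)
  | FImp p q => sat v V p -> sat v V q
  | FAll p => forall a, sat (a .: v) V p
  | FAllS p => forall X, sat v (X .: V) p
  end.

Lemma eval_subst v s t : eval v (subst_term s t) = eval (fun k => eval v (s k)) t.
Proof. by elim: t => //= t -> u ->. Qed.

Lemma sat_subst v V s z p :
  sat v V (subst s z p) <-> sat (fun k => eval v (s k)) (fun k => V (z k)) p.
Proof.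
elim: p v V s z => //=.
- by move=> t u *; rewrite !eval_subst.
- by move=> t u *; rewrite !eval_subst.
- by move=> t X *; rewrite !eval_subst.
- by move=> p IHp q IHq *; rewrite IHp IHq.
- move=> p IH v V s z.
  suff E a : (fun k => eval (a .: v) (up s k)) = a .: (fun k => eval v (s k)).
    by split=> H a; move: (H a); rewrite IH E.
  by apply: functional_extensionality => -[//|k]; rewrite /= /lift_term eval_subst.
- move=> p IH v V s z.
  suff E X : (fun k => (X .: V) (upS z k)) = X .: (fun k => V (z k)).
    by split=> H X; move: (H X); rewrite IH E.
  by apply: functional_extensionality => -[].
Qed.

End Semantics.

(** * Completeness *)

Definition models (T : form -> Prop) (M : model) :=
  forall p v V, T p -> sat (M := M) v V p.

Definition subst_closed (T : form -> Prop) :=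
  forall s z p, T p -> T (subst s z p).

Lemma prv_weaken T G p : prv T G p -> forall G', incl G G' -> prv T G' p.
Proof.
elim=> {G p}.
- by move=> G p Tp G' _; apply: prv_ax.
- by move=> G p Gp G' sG; apply: prv_hyp; apply: sG.
- move=> G p q _ IH G' sG; apply: prv_impI; apply: IH.
  by apply: incl_cons; [left | apply: incl_tl].
- by move=> G p q _ IHp _ IHq G' sG; apply: prv_impE (IHp _ sG) (IHq _ sG).
- move=> G p _ IH G' sG; apply: prv_raa; apply: IH.
  by apply: incl_cons; [left | apply: incl_tl].
- by move=> G p _ IH G' sG; apply: prv_allI; apply: IH; apply: incl_map.
- by move=> G p t _ IH G' sG; apply: prv_allE; apply: IH.
- by move=> G p _ IH G' sG; apply: prv_allSI; apply: IH; apply: incl_map.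
- by move=> G p t _ IH G' sG; apply: prv_allSE; apply: IH.
- by move=> *; apply: prv_refl.
- by move=> G t u p _ IHe _ IHp G' sG; apply: prv_leibniz (IHe _ sG) (IHp _ sG).
Qed.

Lemma prv_subst T (clT : subst_closed T) G p :
  prv T G p -> forall s z, prv T (map (subst s z) G) (subst s z p).
Proof.
elim=> {G p}.
- by move=> G p Tp s z; apply/prv_ax/clT.
- by move=> G p Gp s z; apply/prv_hyp/in_map.
- by move=> G p q _ IH s z; apply: prv_impI; apply: IH.
- by move=> G p q _ IHp _ IHq s z; apply: prv_impE (IHp s z) (IHq s z).
- by move=> G p _ IH s z; apply: prv_raa; apply: IH.
- move=> G p _ IH s z; apply: prv_allI.
  move: (IH (up s) z); rewrite !map_map.
  by rewrite (map_ext _ _ (subst_lift s z)).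
- by move=> G p t _ IH s z; rewrite subst_inst; apply: prv_allE; apply: IH.
- move=> G p _ IH s z; apply: prv_allSI.
  move: (IH s (upS z)); rewrite !map_map.
  by rewrite (map_ext _ _ (subst_liftS s z)).
- by move=> G p X _ IH s z; rewrite subst_instS; apply: prv_allSE; apply: IH.
- by move=> *; apply: prv_refl.
- move=> G t u p _ IHe _ IHp s z; rewrite subst_inst.
  by apply: prv_leibniz (IHe s z) _; rewrite -subst_inst.
Qed.

(** The free variables are bounded through their effect on substitution. In this form the bound
    applies directly to the renamings in [generalize], without a recursive account of free
    variables. *)
Definition nbound n p := forall s s' z,
  (forall k, k < n -> s k = s' k) -> subst s z p = subst s' z p.
Definition sbound n p := forall s z z',
  (forall k, k < n -> z k = z' k) -> subst s z p = subst s z' p.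

Lemma term_nbound t : exists n, forall s s' : nat -> term,
  (forall k, k < n -> s k = s' k) -> subst_term s t = subst_term s' t.
Proof.
elim: t => [k||| t [n Hn] u [m Hm] | t [n Hn] u [m Hm]];
  try by [exists 0].
- by exists (S k) => s s' H /=; apply: H.
- exists (n + m) => s s' H /=.
  by rewrite (Hn _ s') ?(Hm _ s') // => k kn; apply: H; lia.
- exists (n + m) => s s' H /=.
  by rewrite (Hn _ s') ?(Hm _ s') // => k kn; apply: H; lia.
Qed.

Lemma form_nbound p : exists n, nbound n p.
Proof.
elim: p => [|t u|t u|t X|p [n Hn] q [m Hm]|p [n Hn]|p [n Hn]].
- by exists 0.
- have [n Hn] := term_nbound t; have [m Hm] := term_nbound u.
  exists (n + m) => s s' z H /=.
  by rewrite (Hn _ s') ?(Hm _ s') // => k kn; apply: H; lia.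
- have [n Hn] := term_nbound t; have [m Hm] := term_nbound u.
  exists (n + m) => s s' z H /=.
  by rewrite (Hn _ s') ?(Hm _ s') // => k kn; apply: H; lia.
- by have [n Hn] := term_nbound t; exists n => s s' z H /=; rewrite (Hn _ s').
- exists (n + m) => s s' z H /=.
  by rewrite (Hn _ s') ?(Hm _ s') // => k kn; apply: H; lia.
- exists n => s s' z H /=; congr FAll; apply: Hn => -[//|k] kn /=.
  by rewrite H //; lia.
- by exists n => s s' z H /=; congr FAllS; apply: Hn.
Qed.

Lemma form_sbound p : exists n, sbound n p.
Proof.
elim: p => [|t u|t u|t X|p [n Hn] q [m Hm]|p [n Hn]|p [n Hn]];
  try by [exists 0].
- by exists (S X) => s z z' H /=; rewrite H.
- exists (n + m) => s z z' H /=.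
  by rewrite (Hn _ z z') ?(Hm _ z z') // => k kn; apply: H; lia.
- by exists n => s z z' H /=; congr FAll; apply: Hn.
- exists n => s z z' H /=; congr FAllS; apply: Hn => -[//|k] kn /=.
  by rewrite H //; lia.
Qed.

Lemma bound_list (B : nat -> form -> Prop) :
  (forall n m p, n <= m -> B n p -> B m p) -> (forall p, exists n, B n p) ->
  forall G, exists n, forall p, In p G -> B n p.
Proof.
move=> mono ex; elim=> [|p G [n Hn]]; first by exists 0.
have [m Hm] := ex p; exists (n + m) => q /= [<-|/Hn].
  by apply: mono Hm; lia.
by apply: mono; lia.
Qed.

Lemma list_nbound G : exists n, forall p, In p G -> nbound n p.
Proof.
apply: bound_list form_nbound G => n m p nm H s s' z E.
by apply: H => k kn; apply: E; lia.
Qed.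

Lemma list_sbound G : exists n, forall p, In p G -> sbound n p.
Proof.
apply: bound_list form_sbound G => n m p nm H s z z' E.
by apply: H => k kn; apply: E; lia.
Qed.

(** The rule [prv_allI] shifts the context, whereas the Henkin construction keeps its context and
    picks a fresh variable. As [T] is closed under substitution, a whole derivation can be renamed
    to pass from one form to the other. *)
Lemma generalize T (clT : subst_closed T) n p G :
  nbound n (FAll p) -> (forall q, In q G -> nbound n q) ->
  prv T (FNeg (inst (TVar n) p) :: G) FBot -> prv T G (FAll p).
Proof.
move=> np nG H; apply: prv_allI; apply: prv_raa.
(* Rename the fresh variable [n] to 0 and shift the others. *)
pose s k := if Nat.eqb k n then TVar 0 else TVar (S k).
have sE k : k < n -> s k = TVar (S k).
  by rewrite /s => kn; case: Nat.eqb_spec => //; lia.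
have EG q : In q G -> subst s id_set q = lift q.
  by move=> /nG nq; apply: nq.
have Ep : subst s id_set (inst (TVar n) p) = p.
  rewrite subst_inst /= inst_up.
  have [Ea] : FAll (subst (up s) id_set p)
           = FAll (subst (up (fun k => TVar (S k))) id_set p).
    by apply: (np s (fun k => TVar (S k)) id_set sE).
  rewrite -inst_up Ea inst_up /s Nat.eqb_refl -[RHS]subst_id.
  by congr (subst _ _ p); apply: functional_extensionality => -[].
move: (prv_subst clT H s id_set) => /=; rewrite Ep.
by rewrite (map_ext_in _ _ _ EG).
Qed.

Lemma generalizeS T (clT : subst_closed T) n p G :
  sbound n (FAllS p) -> (forall q, In q G -> sbound n q) ->
  prv T (FNeg (instS n p) :: G) FBot -> prv T G (FAllS p).
Proof.
move=> np nG H; apply: prv_allSI; apply: prv_raa.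
pose s k := if Nat.eqb k n then 0 else S k.
have sE k : k < n -> s k = S k.
  by rewrite /s => kn; case: Nat.eqb_spec => //; lia.
have EG q : In q G -> subst TVar s q = liftS q.
  by move=> /nG nq; apply: nq.
have Ep : subst TVar s (instS n p) = p.
  rewrite subst_instS /= instS_up.
  have [Ea] : FAllS (subst TVar (upS s) p) = FAllS (subst TVar (upS S) p).
    by apply: (np TVar s S sE).
  rewrite -instS_up Ea instS_up /s Nat.eqb_refl -[RHS]subst_id.
  by congr (subst _ _ p); apply: functional_extensionality => -[].
move: (prv_subst clT H TVar s) => /=; rewrite Ep.
by rewrite (map_ext_in _ _ _ EG).
Qed.

(** * Enumeration of the formulas *)

Fixpoint decode_term (f c : nat) : term :=
  match f with
  | O => TZero
  | S f =>
    let (i, c) := of_nat c in let (a, b) := of_nat c in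
    match i with
    | 0 => TVar a
    | 1 => TZero
    | 2 => TOne
    | 3 => TAdd (decode_term f a) (decode_term f b)
    | _ => TMul (decode_term f a) (decode_term f b)
    end
  end.

Fixpoint decode_form (f c : nat) : form :=
  match f with
  | O => FBot
  | S f =>
    let (i, c) := of_nat c in let (a, b) := of_nat c in
    match i with
    | 0 => FBot
    | 1 => FEq (decode_term f a) (decode_term f b)
    | 2 => FLt (decode_term f a) (decode_term f b)
    | 3 => FMem (decode_term f a) b
    | 4 => FImp (decode_form f a) (decode_form f b)
    | 5 => FAll (decode_form f a)
    | _ => FAllS (decode_form f a)
    end
  end.

(** The recursion depth is part of the index, so surjectivity needs no relation between a code and
    the size of the formula coded. *)
Definition nth_form n := let (f, c) := of_nat n in decode_form f c.

Ltac decode i a b :=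
  exists (to_nat (i, to_nat (a, b))) => -[|f] lef; first lia;
  cbn -[of_nat to_nat]; rewrite !cancel_of_to.

Lemma decode_term_onto t :
  exists n c, forall f, n <= f -> decode_term f c = t.
Proof.
elim: t => [k||| t [n [a Ht]] u [m [b Hu]] | t [n [a Ht]] u [m [b Hu]]].
- by exists 1; decode 0 k 0.
- by exists 1; decode 1 0 0.
- by exists 1; decode 2 0 0.
- by exists (S (n + m)); decode 3 a b; rewrite Ht ?Hu //; lia.
- by exists (S (n + m)); decode 4 a b; rewrite Ht ?Hu //; lia.
Qed.

Lemma decode_form_onto p :
  exists n c, forall f, n <= f -> decode_form f c = p.
Proof.
elim: p => [|t u|t u|t X|p [n [a Hp]] q [m [b Hq]]|p [n [a Hp]]|p [n [a Hp]]].
- by exists 1; decode 0 0 0.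
- have [n [a Ht]] := decode_term_onto t; have [m [b Hu]] := decode_term_onto u.
  by exists (S (n + m)); decode 1 a b; rewrite Ht ?Hu //; lia.
- have [n [a Ht]] := decode_term_onto t; have [m [b Hu]] := decode_term_onto u.
  by exists (S (n + m)); decode 2 a b; rewrite Ht ?Hu //; lia.
- have [n [a Ht]] := decode_term_onto t.
  by exists (S n); decode 3 a X; rewrite Ht //; lia.
- by exists (S (n + m)); decode 4 a b; rewrite Hp ?Hq //; lia.
- by exists (S n); decode 5 a 0; rewrite Hp //; lia.
- by exists (S n); decode 6 a 0; rewrite Hp //; lia.
Qed.

Lemma nth_form_onto p : exists n, nth_form n = p.
Proof.
have [f [c H]] := decode_form_onto p.
by exists (to_nat (f, c)); rewrite /nth_form cancel_of_to; apply: H.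
Qed.

(** * The Henkin construction *)

Section Henkin.
Variable T : form -> Prop.
Hypothesis clT : subst_closed T.
Variable G0 : list form.
Hypothesis con0 : ~ prv T G0 FBot.

Definition fresh_var (G : list form) : nat :=
  epsilon (inhabits 0) (fun n => forall p, In p G -> nbound n p).
Definition fresh_set (G : list form) : nat :=
  epsilon (inhabits 0) (fun n => forall p, In p G -> sbound n p).

Lemma fresh_varP G p : In p G -> nbound (fresh_var G) p.
Proof. by move: p; apply: (epsilon_spec _ _ (list_nbound G)). Qed.
Lemma fresh_setP G p : In p G -> sbound (fresh_set G) p.
Proof. by move: p; apply: (epsilon_spec _ _ (list_sbound G)). Qed.

(** Variables serve as Henkin constants: each stage is a finite list, so a fresh variable always
    exists and the language need not be extended. The head of the list is the formula just added. *)
Definition add_witness (G : list form) : list form :=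
  match G with
  | FImp (FAll q) FBot :: _ => FNeg (inst (TVar (fresh_var G)) q) :: G
  | FImp (FAllS q) FBot :: _ => FNeg (instS (fresh_set G) q) :: G
  | _ => G
  end.

Definition extend (G : list form) (p : form) : list form :=
  match excluded_middle_informative (prv T (p :: G) FBot) with
  | left _ => G
  | right _ => add_witness (p :: G)
  end.

Fixpoint stage n := match n with O => G0 | S n => extend (stage n) (nth_form n) end.

Lemma add_witness_incl G : incl G (add_witness G).
Proof.
case: G => [//|p G]; rewrite /add_witness.
have I q : incl (p :: G) (q :: p :: G) by apply: incl_tl; apply: incl_refl.
have J : incl (p :: G) (p :: G) by apply: incl_refl.
by case: p I J => // -[] // ? [].
Qed.

(** If the counterexample led to a contradiction, generalization over the fresh variable would prove
    the universal formula whose negation heads the list. *)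
Lemma add_witness_con G : ~ prv T G FBot -> ~ prv T (add_witness G) FBot.
Proof.
case: G => [//|[] // [] // q [] // G] con.
- rewrite /add_witness; set H := _ :: G => P; apply: con.
  apply: (prv_impE _ _ (FAll q)); first by apply: prv_hyp; left.
  apply: (generalize clT _ _ P); last by move=> r; apply: fresh_varP.
  have /fresh_varP nq : In (FImp (FAll q) FBot) H by left.
  by move=> s s' z E; move: (nq s s' z E) => /= [->].
- rewrite /add_witness; set H := _ :: G => P; apply: con.
  apply: (prv_impE _ _ (FAllS q)); first by apply: prv_hyp; left.
  apply: (generalizeS clT _ _ P); last by move=> r; apply: fresh_setP.
  have /fresh_setP nq : In (FImp (FAllS q) FBot) H by left.
  by move=> s s' z E; move: (nq s s' z E) => /= [->].
Qed.

Lemma stage_con n : ~ prv T (stage n) FBot.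
Proof.
elim: n => //= n IH; rewrite /extend.
by case: excluded_middle_informative => // con; apply: add_witness_con.
Qed.

Lemma stage_mono n m : n <= m -> incl (stage n) (stage m).
Proof.
elim=> [|{}m _ IH]; first exact: incl_refl.
move=> p /IH {IH}; rewrite /= /extend.
case: excluded_middle_informative => // con Hp.
by apply: add_witness_incl; right.
Qed.

Definition theory p := exists n, prv T (stage n) p.

Lemma theory_con : ~ theory FBot.
Proof. by case=> n /stage_con. Qed.

Lemma theory2 p q r : (forall G, prv T G p -> prv T G q -> prv T G r) ->
  theory p -> theory q -> theory r.
Proof.
move=> H [n Hp] [m Hq]; exists (n + m).
by apply: H; [apply: (prv_weaken Hp) | apply: (prv_weaken Hq)];
  apply: stage_mono; lia.
Qed.

Lemma theory1 p r : (forall G, prv T G p -> prv T G r) -> theory p -> theory r.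
Proof. by move=> H tp; apply: (theory2 (p := p) (q := p)) => // G _; apply: H. Qed.

Lemma theory0 r : (forall G, prv T G r) -> theory r.
Proof. by exists 0. Qed.

Lemma theory_neg p : theory p -> theory (FNeg p) -> False.
Proof.
move=> Hp Hn; apply: theory_con; apply: theory2 Hn Hp => G; exact: prv_impE.
Qed.

Lemma theory_dec p : theory p \/ theory (FNeg p).
Proof.
have [n E] := nth_form_onto p.
case: (excluded_middle_informative (prv T (p :: stage n) FBot)) => H.
  by right; exists n; apply: prv_impI.
left; exists (S n); apply: prv_hyp; rewrite /= /extend E.
by case: excluded_middle_informative => // _; apply: add_witness_incl; left.
Qed.

Lemma theory_imp p q : theory (FImp p q) <-> (theory p -> theory q).
Proof.
split=> [Hpq Hp|H]; first by apply: theory2 Hpq Hp => G; exact: prv_impE.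
have [/H|] := theory_dec p.
  apply: theory1 => G Hq; apply: prv_impI; apply: (prv_weaken Hq).
  by apply: incl_tl; apply: incl_refl.
apply: theory1 => G Hn; apply: prv_impI; apply: prv_raa.
apply: (prv_impE _ _ p _); last by apply: prv_hyp; right; left.
by apply: (prv_weaken Hn); do 2 apply: incl_tl; apply: incl_refl.
Qed.

Lemma theory_all p : theory (FAll p) <-> forall t, theory (inst t p).
Proof.
split=> [H t|H]; first by apply: theory1 H => G; apply: prv_allE.
case: (theory_dec (FAll p)) => // Hn; exfalso.
have [n E] := nth_form_onto (FNeg (FAll p)).
set G := FNeg (FAll p) :: stage n.
(* The negated formula belongs to the theory, hence is consistent with stage [n], where its turn
   comes; it is added there together with a counterexample. *)
apply: (theory_neg (H (TVar (fresh_var G)))).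
exists (S n); apply: prv_hyp; rewrite /= /extend E.
case: excluded_middle_informative => [P|_]; last by left.
by exfalso; apply: (theory_neg Hn); exists n; apply: prv_impI.
Qed.

Lemma theory_allS p : theory (FAllS p) <-> forall X, theory (instS X p).
Proof.
split=> [H X|H]; first by apply: theory1 H => G; apply: prv_allSE.
case: (theory_dec (FAllS p)) => // Hn; exfalso.
have [n E] := nth_form_onto (FNeg (FAllS p)).
set G := FNeg (FAllS p) :: stage n.
apply: (theory_neg (H (fresh_set G))).
exists (S n); apply: prv_hyp; rewrite /= /extend E.
case: excluded_middle_informative => [P|_]; last by left.
by exfalso; apply: (theory_neg Hn); exists n; apply: prv_impI.
Qed.

(** * The term model *)

Definition teq t u := theory (FEq t u).

Lemma teq_refl t : teq t t.
Proof. by apply: theory0 => G; apply: prv_refl. Qed.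

Lemma teq_leibniz t u p : teq t u -> theory (inst t p) -> theory (inst u p).
Proof. by apply: theory2 => G; apply: prv_leibniz. Qed.

Lemma inst_lift_term t u : subst_term (t .: TVar) (lift_term u) = u.
Proof. by rewrite /lift_term subst_term_comp subst_term_id. Qed.

Lemma teq_sym t u : teq t u -> teq u t.
Proof.
move=> E; have := @teq_leibniz t u (FEq (TVar 0) (lift_term t)) E.
by rewrite !inst_eq /= !inst_lift_term; apply; apply: teq_refl.
Qed.

Lemma teq_trans t u r : teq t u -> teq u r -> teq t r.
Proof.
move=> E F; have := @teq_leibniz u r (FEq (lift_term t) (TVar 0)) F.
by rewrite !inst_eq /= !inst_lift_term; apply.
Qed.

Lemma teq_fun (f : term -> term -> term) t t' u u' :
  (forall s a b, subst_term s (f a b) = f (subst_term s a) (subst_term s b)) ->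
  teq t t' -> teq u u' -> teq (f t u) (f t' u').
Proof.
move=> Hf E F.
have := @teq_leibniz t t' (FEq (lift_term (f t u)) (f (TVar 0) (lift_term u))) E.
rewrite !inst_eq /= !Hf !inst_lift_term => /(_ (teq_refl _)) E1.
have := @teq_leibniz u u' (FEq (lift_term (f t u)) (f (lift_term t') (TVar 0))) F.
by rewrite !inst_eq /= !Hf !inst_lift_term; apply.
Qed.

Let cls t : quot teq := cls teq t.
Let cls_eq t u : cls t = cls u <-> teq t u := cls_eq teq_refl teq_sym teq_trans t u.
Let cls_rep (c : quot teq) : cls (rep c) = c := cls_rep c.
Let teq_rep t : teq (rep (cls t)) t := rep_cls teq_refl teq_sym teq_trans t.

(** The sets are the set variables themselves: the language has no equality of sets, so there is
    nothing to factor out on that sort. *)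
Definition term_model : model :=
  @Model (quot teq) nat (cls TZero) (cls TOne)
    (fun c d => cls (TAdd (rep c) (rep d))) (fun c d => cls (TMul (rep c) (rep d)))
    (fun c d => theory (FLt (rep c) (rep d))) (fun c X => theory (FMem (rep c) X)).

Lemma eval_cls s t :
  eval (M := term_model) (fun k => cls (s k)) t = cls (subst_term s t).
Proof.
elim: t => //= t -> u ->; apply/cls_eq;
  by apply: teq_fun => //; apply: teq_rep.
Qed.

Lemma theory_lt t t' u u' :
  teq t t' -> teq u u' -> theory (FLt t u) -> theory (FLt t' u').
Proof.
move=> E F H.
have := @teq_leibniz t t' (FLt (TVar 0) (lift_term u)) E.
rewrite !inst_eq /= !inst_lift_term => /(_ H) H1.
have := @teq_leibniz u u' (FLt (lift_term t') (TVar 0)) F.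
by rewrite !inst_eq /= !inst_lift_term; apply.
Qed.

Lemma theory_mem t t' X : teq t t' -> theory (FMem t X) -> theory (FMem t' X).
Proof. by move=> E; apply: (@teq_leibniz t t' (FMem (TVar 0) X) E). Qed.

(** The substitution is kept general so that the instances arising at a quantifier fall under the
    induction hypothesis. Every number assignment has the form [cls (s k)], since [cls] is
    surjective. *)
Lemma truth p s z :
  sat (M := term_model) (fun k => cls (s k)) z p <-> theory (subst s z p).
Proof.
elim: p s z => [|t u|t u|t X|p IHp q IHq|p IH|p IH] s z /=.
- by split=> // /theory_con.
- by rewrite !eval_cls; apply: cls_eq.
- rewrite !eval_cls; split; apply: theory_lt; do ?exact: teq_rep;
  by apply: teq_sym; apply: teq_rep.
- rewrite !eval_cls; split; apply: theory_mem; do ?exact: teq_rep;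
  by apply: teq_sym; apply: teq_rep.
- by rewrite theory_imp IHp IHq.
- rewrite theory_all; split=> H.
  + move=> t; rewrite inst_up -IH; move: (H (cls t)).
    by congr sat; apply: functional_extensionality => -[].
  + move=> c; move: (H (rep c)); rewrite inst_up -IH.
    by congr sat; apply: functional_extensionality => -[|//]; apply: cls_rep.
- rewrite theory_allS; split=> H.
  + by move=> X; rewrite instS_up -IH; apply: H.
  + by move=> X; move: (H X); rewrite instS_up -IH.
Qed.

Lemma term_model_models : models T term_model.
Proof.
move=> p v V Tp.
have -> : v = (fun k => cls (rep (v k))).
  by apply: functional_extensionality => k; rewrite cls_rep.
by apply/truth; apply: theory0 => G; apply/prv_ax/clT.
Qed.

Lemma term_model_hyp p : In p G0 -> sat (M := term_model) (fun k => cls (TVar k)) id_set p.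
Proof. by move=> H; apply/truth; rewrite subst_id; exists 0; apply: prv_hyp. Qed.

End Henkin.

Theorem completeness T p : subst_closed T ->
  (forall M v V, models T M -> sat (M := M) v V p) -> provable T p.
Proof.
move=> clT H; apply: prv_raa; apply: NNPP => con.
have := @term_model_hyp _ clT _ con (FNeg p) (or_introl eq_refl).
by apply; apply/H/term_model_models.
Qed.

(** * Closure of RCA_0 under substitution *)

Lemma delta0_subst p : delta0 p -> forall s z, delta0 (subst s z p).
Proof.
elim=> {p} /=; try by constructor.
move=> t p _ IH s z; rewrite up_lift; exact: delta0_ball.
Qed.

(** Substitution carries instances of a scheme to instances with other parameters. For induction the
    point is that replacing the induction variable by its successor commutes with a substitution for
    the remaining variables. *)
Lemma RCA0_subst_closed : subst_closed RCA0.
Proof.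
move=> s z p [] {p}.
- move=> p Hp; suff -> : subst s z p = p by apply: RCA0_basic.
  by move: Hp; do ![case=> [<- //|]].
- move=> p [q [dq ->]].
  pose r k := match k with O => TAdd (TVar O) TOne | S k => TVar (S k) end.
  have E1 : subst (up s) z (subst r id_set (FEx q))
          = subst r id_set (subst (up s) z (FEx q)).
    rewrite !subst_comp; congr (subst _ _ (FEx q)).
    by apply: functional_extensionality => -[|k] //=;
      rewrite /lift_term !subst_term_comp.
  have -> : subst s z (induction (FEx q)) = induction (subst (up s) z (FEx q)).
    by rewrite /induction -[inst TZero (subst _ _ _)](subst_inst TZero s) -/r -E1.
  apply: RCA0_sigma1_induction; exists (subst (up (up s)) z q); split=> //.
  exact: delta0_subst.
- move=> p q [p1 [d1 ->]] [q1 [d2 ->]].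
  pose p' := subst (up (up s)) z p1; pose q' := subst (up (up s)) z q1.
  have -> : subst s z (comprehension (FEx p1) (FAll q1))
           = comprehension (FEx p') (FAll q').
    rewrite -[FEx p']/(subst (up s) z (FEx p1)) -[FAll q']/(subst (up s) z (FAll q1)).
    by rewrite /comprehension -subst_liftS.
  apply: RCA0_delta1_comprehension; [exists p' | exists q'];
    by split=> //; apply: delta0_subst.
Qed.

(** * Definability in a model *)

Declare Scope dom_scope.
Delimit Scope dom_scope with dom.
Notation "'𝟎'" := (m0 _) : dom_scope.
Notation "'𝟏'" := (m1 _) : dom_scope.
Notation "x + y" := (madd x y) : dom_scope.
Notation "x * y" := (mmul x y) : dom_scope.
Notation "x < y" := (mlt x y) : dom_scope.
Notation "x '∈' X" := (mmem x X) : dom_scope.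
Definition mle (M : model) (x y : M) : Prop := mlt x y \/ x = y.
Notation "x <= y" := (mle x y) : dom_scope.
Open Scope dom_scope.

Section Definability.
Variable M : model.

Definition entry (v : nat -> M) (e : nat + M) : M :=
  match e with inl k => v k | inr a => a end.

(** The variables of a defining formula stand for arguments of the predicate or
    for parameters, according to [e]. *)
Definition Def (P : (nat -> M) -> Prop) : Prop :=
  exists q (e : nat -> nat + M) V, delta0 q
    /\ forall v, sat (fun k => entry v (e k)) V q <-> P v.

Definition Tm (f : (nat -> M) -> M) : Prop :=
  exists t (e : nat -> nat + M), forall v, eval (fun k => entry v (e k)) t = f v.

Lemma Def_ext P Q : (forall v, P v <-> Q v) -> Def P -> Def Q.
Proof.
move=> E [q [e [V [dq H]]]]; exists q, e, V; split=> // v.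
by rewrite H.
Qed.

(** Combines the environments of several formulas into one: variable [k] of the [j]-th formula is
    renamed to [to_nat (j, k)], so that different formulas share no variable. *)
Definition merge A (f : nat -> nat -> A) (n : nat) : A :=
  let (j, k) := of_nat n in f j k.

Lemma mergeE A (f : nat -> nat -> A) j k : merge f (to_nat (j, k)) = f j k.
Proof. by rewrite /merge cancel_of_to. Qed.

Lemma Tm_merge (f : nat -> (nat -> M) -> M) : (forall j, Tm (f j)) ->
  exists t e, forall j v, eval (fun k => entry v (e k)) (t j) = f j v.
Proof.
move=> H.
have {}H j : exists te : term * (nat -> nat + M), forall v,
    eval (fun k => entry v (snd te k)) (fst te) = f j v.
  by have [t [e E]] := H j; exists (t, e).
pose t j := proj1_sig (constructive_indefinite_description _ (H j)).
have Ht j : forall v, eval (fun k => entry v (snd (t j) k)) (fst (t j)) = f j v :=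
  proj2_sig (constructive_indefinite_description _ (H j)).
exists (fun j => subst_term (fun k => TVar (to_nat (j, k))) (fst (t j))).
exists (merge (fun j => snd (t j))) => j v; rewrite eval_subst /= -Ht.
by congr eval; apply: functional_extensionality => k; rewrite mergeE.
Qed.

Lemma Tm2_merge f g : Tm f -> Tm g -> exists t u e,
  forall v, eval (fun k => entry v (e k)) t = f v
         /\ eval (fun k => entry v (e k)) u = g v.
Proof.
move=> Hf Hg.
have [|t [e E]] := @Tm_merge (fun j => match j with O => f | _ => g end).
  by case.
by exists (t 0), (t 1), e => v; split; [apply: (E 0) | apply: (E 1)].
Qed.

Lemma Tm_var k : Tm (fun v => v k).
Proof. by exists (TVar 0), (fun _ => inl k). Qed.
Lemma Tm_const a : Tm (fun _ => a).
Proof. by exists (TVar 0), (fun _ => inr a). Qed.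
Lemma Tm_add f g : Tm f -> Tm g -> Tm (fun v => f v + g v).
Proof.
move=> Hf Hg; have [t [u [e E]]] := Tm2_merge Hf Hg.
by exists (TAdd t u), e => v /=; have [-> ->] := E v.
Qed.
Lemma Tm_mul f g : Tm f -> Tm g -> Tm (fun v => f v * g v).
Proof.
move=> Hf Hg; have [t [u [e E]]] := Tm2_merge Hf Hg.
by exists (TMul t u), e => v /=; have [-> ->] := E v.
Qed.


Variable X0 : sets M.

Lemma Def_False : Def (fun _ => False).
Proof.
by exists FBot, (fun _ => inl 0), (fun _ => X0); split=> //; apply: delta0_bot.
Qed.

Lemma Def_eq f g : Tm f -> Tm g -> Def (fun v => f v = g v).
Proof.
move=> Hf Hg; have [t [u [e E]]] := Tm2_merge Hf Hg.
exists (FEq t u), e, (fun _ => X0); split=> [|v]; first exact: delta0_eq.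
by move=> /=; have [-> ->] := E v.
Qed.

Lemma Def_lt f g : Tm f -> Tm g -> Def (fun v => f v < g v).
Proof.
move=> Hf Hg; have [t [u [e E]]] := Tm2_merge Hf Hg.
exists (FLt t u), e, (fun _ => X0); split=> [|v]; first exact: delta0_lt.
by move=> /=; have [-> ->] := E v.
Qed.

Lemma Def_mem X f : Tm f -> Def (fun v => f v ∈ X).
Proof.
move=> [t [e E]].
exists (FMem t 0), e, (fun _ => X); split=> [|v]; first exact: delta0_mem.
by rewrite /= E.
Qed.

Lemma Def_imp P Q : Def P -> Def Q -> Def (fun v => P v -> Q v).
Proof.
move=> [p [e [V [dp Hp]]]] [q [e' [V' [dq Hq]]]].
pose r j k := TVar (to_nat (j, k)); pose z j k := to_nat (j, k).
exists (FImp (subst (r 0) (z 0) p) (subst (r 1) (z 1) q)).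
exists (merge (fun j => match j with O => e | _ => e' end)).
exists (merge (fun j => match j with O => V | _ => V' end)).
split=> [|v]; first by apply: delta0_imp; apply: delta0_subst.
rewrite -Hp -Hq /= !sat_subst.
set a := sat _ _ p; set b := sat _ _ q; set c := sat _ _ p; set d := sat _ _ q.
have -> : a = c.
  by congr sat; apply: functional_extensionality => k; rewrite /= mergeE.
suff -> : b = d by [].
by congr sat; apply: functional_extensionality => k; rewrite /= mergeE.
Qed.

Lemma Def_not P : Def P -> Def (fun v => ~ P v).
Proof. by move=> H; apply: Def_imp H Def_False. Qed.

Lemma Def_and P Q : Def P -> Def Q -> Def (fun v => P v /\ Q v).
Proof.
move=> HP HQ; apply: (Def_ext _ (Def_not (Def_imp HP (Def_not HQ)))) => v.
tauto.
Qed.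

Lemma Def_or P Q : Def P -> Def Q -> Def (fun v => P v \/ Q v).
Proof.
move=> HP HQ; apply: (Def_ext _ (Def_imp (Def_not HP) HQ)) => v.
tauto.
Qed.

Lemma Def_le f g : Tm f -> Tm g -> Def (fun v => f v <= g v).
Proof. by move=> Hf Hg; apply: Def_or; [apply: Def_lt | apply: Def_eq]. Qed.

(** Several variables of the defining formula may stand for argument 0; all of them are identified
    with the one variable that a quantifier will bind. The other variables are moved out of its way,
    and argument i + 1 becomes argument i. *)
Lemma Def_shift P : Def P -> forall (f : (nat -> M) -> M), Tm f ->
  exists t q e V, delta0 q /\ forall v,
    eval (fun k => entry v (e k)) t = f v /\
    forall a, sat (a .: (fun k => entry v (e k))) V q <-> P (a .: v).
Proof.
move=> [q [e [V [dq Hq]]]] f [t [e' Ht]].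
pose r k := match e k with
  | inl O => TVar 0 | _ => TVar (S (to_nat (0, k))) end.
pose d k := match e k with
  | inl (S i) => inl i | inl O => inl O | inr c => inr c end.
exists (subst_term (fun k => TVar (to_nat (1, k))) t), (subst r id_set q).
exists (merge (fun j => match j with O => d | _ => e' end)), V.
split=> [|v]; first exact: delta0_subst.
split=> [|a].
  rewrite eval_subst -Ht; congr eval.
  by apply: functional_extensionality => k; rewrite /= mergeE.
rewrite -Hq sat_subst.
set b := sat _ _ q; set c := sat _ _ q; suff -> : b = c by [].
congr sat; apply: functional_extensionality => k; rewrite /r.
by case E : (e k) => [[|i]|x] //; rewrite /scons [eval _ _]/= mergeE /d E.
Qed.

Lemma Def_ball P f : Tm f -> Def (fun v => P (v 0) (fun k => v (S k))) ->
  Def (fun v => forall a, a < f v -> P a v).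
Proof.
move=> Hf HP; have [t [q [e [V [dq H]]]]] := Def_shift HP Hf.
exists (FAll (FImp (FLt (TVar 0) (lift_term t)) q)), e, V.
split=> [|v]; first exact: delta0_ball.
have [Et Eq] := H v; split=> /= K a; move: (K a);
  by rewrite /lift_term eval_subst Et (Eq a).
Qed.

Lemma Def_bex P f : Tm f -> Def (fun v => P (v 0) (fun k => v (S k))) ->
  Def (fun v => exists a, a < f v /\ P a v).
Proof.
move=> Hf HP.
apply: (Def_ext _ (Def_not (Def_ball (P := fun a v => ~ P a v) Hf (Def_not HP)))) => v.
split=> [H|[a [? ?]] H]; last by apply: (H a).
apply: NNPP => H1; apply: H => a Ha Pa; apply: H1; by exists a.
Qed.

Lemma Def_comp P (f : nat -> (nat -> M) -> M) : Def P -> (forall j, Tm (f j)) ->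
  Def (fun v => P (fun k => f k v)).
Proof.
move=> [q [e [V [dq Hq]]]] Hf.
pose g k v := match e k with inl j => f j v | inr a => a end.
have [|t [e' E]] := @Tm_merge g.
  by move=> k; rewrite /g; case: (e k) => [j|a]; last exact: Tm_const.
exists (subst t id_set q), e', V; split=> [|v]; first exact: delta0_subst.
rewrite sat_subst -Hq.
set b := sat _ _ q; set c := sat _ _ q; suff -> : b = c by [].
congr sat; apply: functional_extensionality => k; rewrite E /g.
by case: (e k).
Qed.

Lemma Def_comp2 (P : M -> M -> Prop) f g :
  Def (fun v => P (v 0) (v 1)) -> Tm f -> Tm g -> Def (fun v => P (f v) (g v)).
Proof.
move=> HP Hf Hg.
by apply: (Def_comp (f := fun k => match k with O => f | _ => g end) HP) => -[].
Qed.

Lemma Def_comp3 (P : M -> M -> M -> Prop) f g h :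
  Def (fun v => P (v 0) (v 1) (v 2)) -> Tm f -> Tm g -> Tm h ->
  Def (fun v => P (f v) (g v) (h v)).
Proof.
move=> HP Hf Hg Hh.
by apply: (Def_comp (f := fun k => match k with O => f | 1 => g | _ => h end) HP)
  => -[|[]].
Qed.

Lemma Def_comp4 (P : M -> M -> M -> M -> Prop) f g h i :
  Def (fun v => P (v 0) (v 1) (v 2) (v 3)) -> Tm f -> Tm g -> Tm h -> Tm i ->
  Def (fun v => P (f v) (g v) (h v) (i v)).
Proof.
move=> HP Hf Hg Hh Hi.
by apply: (Def_comp (f := fun k =>
  match k with O => f | 1 => g | 2 => h | _ => i end) HP) => -[|[|[]]].
Qed.

End Definability.

Ltac def_step :=
  lazymatch goal with
  | |- Tm _ => first
      [ apply: Tm_const | apply: Tm_var | apply: Tm_add | apply: Tm_mul ]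
  | |- Def (fun v => False) => apply: Def_False
  | |- Def (fun v => _ /\ _) => apply: Def_and
  | |- Def (fun v => _ \/ _) => apply: Def_or
  | |- Def (fun v => ~ _) => apply: Def_not
  | |- Def (fun v => mle _ _) => apply: Def_le
  | |- Def (fun v => mlt _ _) => apply: Def_lt
  | |- Def (fun v => mmem _ _) => apply: Def_mem
  | |- Def (fun v => _ = _) => apply: Def_eq
  | |- Def (fun v => forall a, mlt a _ -> _) => apply: Def_ball
  | |- Def (fun v => exists a, mlt a _ /\ _) => apply: Def_bex
  | |- Def (fun v => _ -> _) => apply: Def_imp
  end; cbv beta.
Ltac def := repeat first [def_step | assumption |
  match goal with
  | H : Def (fun v => ?P (v 0) (v 1)) |- Def (fun v => ?P _ _) =>
      apply: (Def_comp2 H)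
  | H : Def (fun v => ?P (v 0) (v 1) (v 2)) |- Def (fun v => ?P _ _ _) =>
      apply: (Def_comp3 H)
  | H : Def (fun v => ?P (v 0) (v 1) (v 2) (v 3)) |- Def (fun v => ?P _ _ _ _) =>
      apply: (Def_comp4 H)
  end].

(** * Induction and comprehension for definable predicates *)

Section Schemes.
Variable M : model.
Hypothesis HM : models RCA0 M.
Variable X0 : sets M.

Lemma sigma1_ind (P : M -> M -> Prop) : Def (fun v => P (v 0) (v 1)) ->
  (exists y, P 𝟎 y) -> (forall x, (exists y, P x y) -> exists y, P (x + 𝟏) y) ->
  forall x, exists y, P x y.
Proof.
move=> [q [e [V [dq Hq]]]] H0 HS.
(* Variable 1 is x and variable 0 is y. Arguments beyond the second may also be read as y, because
   [P] depends on the first two only. *)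
pose r k := match e k with
  | inl O => TVar 1 | inl _ => TVar 0 | _ => TVar (S (S k)) end.
pose c k : M := match e k with inl _ => 𝟎 | inr a => a end.
have E x y : sat (y .: x .: c) V (subst r id_set q) <-> P x y.
  rewrite -(Hq (x .: (fun _ => y))) sat_subst.
  set A := sat _ _ q; set B := sat _ _ q; suff -> : A = B by [].
  congr sat; apply: functional_extensionality => k; rewrite /r /c.
  by case Ee : (e k) => [[|i]|a] //=; rewrite Ee.
have EX x : sat (x .: c) V (FEx (subst r id_set q)) <-> exists y, P x y.
  split=> [H|[y /E Hy] /(_ y) K]; last by apply: K.
  by apply: NNPP => K; apply: H => y /E Hy; apply: K; exists y.
have s1 : sigma1 (FEx (subst r id_set q)).
  by exists (subst r id_set q); split=> //; apply: delta0_subst.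
have K := HM c V (RCA0_sigma1_induction _ s1).
set F := FEx _ in EX K.
have K0 : sat c V (inst TZero F).
  rewrite inst_eq sat_subst; move/EX: H0.
  by congr sat; apply: functional_extensionality => -[].
have KS x : sat (x .: c) V F -> sat (x .: c) V (subst (fun k =>
    match k with O => TAdd (TVar O) TOne | S k => TVar (S k) end) id_set F).
  move=> /EX /HS /EX; rewrite sat_subst.
  by congr sat; apply: functional_extensionality => -[].
by move=> x; apply/EX; apply: (K K0 KS).
Qed.

Lemma bounded_ind (P : M -> Prop) : Def (fun v => P (v 0)) ->
  P 𝟎 -> (forall x, P x -> P (x + 𝟏)) -> forall x, P x.
Proof.
move=> HP H0 HS x.
have [|_ //] := @sigma1_ind (fun x _ => P x) HP (ex_intro _ 𝟎 H0) _ x.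
by move=> y [_ /HS]; exists 𝟎.
Qed.

(** A vacuous quantifier of either kind presents a Delta_0-formula both as Sigma_1 and as Pi_1; this
    is why variable 0 is left free in the renaming [r]. *)
Lemma delta0_comprehension (P : M -> Prop) : Def (fun v => P (v 0)) ->
  exists X, forall x, x ∈ X <-> P x.
Proof.
move=> [q [e [V [dq Hq]]]].
pose r k := match e k with inl _ => TVar 1 | _ => TVar (S (S k)) end.
pose c k : M := match e k with inl _ => 𝟎 | inr a => a end.
set q' := subst r id_set q.
have E x y : sat (y .: x .: c) V q' <-> P x.
  rewrite -(Hq (fun _ => x)) sat_subst.
  set A := sat _ _ q; set B := sat _ _ q; suff -> : A = B by [].
  congr sat; apply: functional_extensionality => k; rewrite /r /c.
  by case Ee : (e k) => [i|a] //=; rewrite Ee.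
have dq' : delta0 q' by apply: delta0_subst.
have s1 : sigma1 (FEx q') by exists q'.
have p1 : pi1 (FAll q') by exists q'.
have Hc := HM c V (RCA0_delta1_comprehension _ _ s1 p1).
have EE x : sat (x .: c) V (FEx q') <-> P x.
  split=> [H|H /(_ 𝟎) K]; last by apply: K; apply/E.
  by apply: NNPP => K; apply: H => y /E.
have EA x : sat (x .: c) V (FAll q') <-> P x.
  by split=> [/(_ 𝟎) /E|H y]; last by apply/E.
apply: NNPP => no; apply: Hc.
  by move=> x K; apply: K => [/EE /EA //|/EA /EE].
move=> X HX; apply: no; exists X => x.
have EX : sat (x .: c) (X .: V) (liftS (FEx q')) <-> P x.
  by rewrite sat_subst -EE.
have {}HX := HX x; apply: NNPP => no2; apply: HX => H1 H2.
by apply: no2; split=> [/H1 /EX|/EX /H2].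
Qed.

End Schemes.

(** * Arithmetic in a model of RCA_0 *)

(** A set is part of the record because [Def] asks for an assignment to the set variables even when
    the formula mentions none. *)
Record rca_model := RcaModel {
  rca_dom :> model; rca_modelP : models RCA0 rca_dom; rca_set : sets rca_dom }.

Section Arithmetic.
Variable M : rca_model.
Let HM : models RCA0 M := @rca_modelP M.
Let X0 : sets M := @rca_set M.
Implicit Types x y z : M.

Let basic k : Nat.ltb k 8 = true ->
  sat (fun _ => 𝟎) (fun _ => X0) (nth k basic_axioms FBot).
Proof.
by move=> H; apply/HM/RCA0_basic/nth_In; apply/Nat.ltb_lt.
Qed.

Lemma madd1_neq0 : forall x, x + 𝟏 <> 𝟎. Proof. exact: (@basic 0). Qed.
Lemma madd1_inj : forall x y, x + 𝟏 = y + 𝟏 -> x = y. Proof. exact: (@basic 1). Qed.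
Lemma maddx0 : forall x, x + 𝟎 = x. Proof. exact: (@basic 2). Qed.
Lemma maddxS : forall x y, x + (y + 𝟏) = (x + y) + 𝟏. Proof. exact: (@basic 3). Qed.
Lemma mmulx0 : forall x, x * 𝟎 = 𝟎. Proof. exact: (@basic 4). Qed.
Lemma mmulxS : forall x y, x * (y + 𝟏) = x * y + x. Proof. exact: (@basic 5). Qed.
Lemma mltx0 : forall x, ~ x < 𝟎. Proof. exact: (@basic 6). Qed.
Lemma mltxS x y : x < y + 𝟏 <-> x <= y.
Proof.
suff H : forall x y, ~ ((x < y + 𝟏 -> (~ x < y -> x = y)) ->
    ~ ((~ x < y -> x = y) -> x < y + 𝟏)).
  by move: (H x y); rewrite /mle; tauto.
exact: (@basic 7).
Qed.

Ltac ind := refine (@bounded_ind _ HM _ _ _ _); cbv beta; [by def | |].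

Lemma madd0x x : 𝟎 + x = x.
Proof. by move: x; ind; [apply: maddx0 | move=> x IH; rewrite maddxS IH]. Qed.
Lemma maddSx x y : (x + 𝟏) + y = (x + y) + 𝟏.
Proof.
by move: y; ind; [rewrite !maddx0 | move=> y IH; rewrite !maddxS IH].
Qed.
Lemma maddC x y : x + y = y + x.
Proof.
by move: y; ind; [rewrite maddx0 madd0x | move=> y IH; rewrite maddxS IH maddSx].
Qed.
Lemma maddA x y z : x + (y + z) = (x + y) + z.
Proof.
by move: z; ind; [rewrite !maddx0 | move=> z IH; rewrite !maddxS IH].
Qed.
Lemma mmul0x x : 𝟎 * x = 𝟎.
Proof.
by move: x; ind; [rewrite mmulx0 | move=> z IH; rewrite mmulxS IH maddx0].
Qed.
Lemma mmulSx x y : (x + 𝟏) * y = x * y + y.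
Proof.
move: y; ind=> [|y IH]; first by rewrite !mmulx0 maddx0.
by rewrite !mmulxS IH !maddxS -!(maddA (x * y)) (maddC y x).
Qed.
Lemma mmulC x y : x * y = y * x.
Proof.
by move: y; ind=> [|y IH]; [rewrite mmulx0 mmul0x | rewrite mmulxS mmulSx IH].
Qed.
Lemma mmulDr x y z : x * (y + z) = x * y + x * z.
Proof.
move: z; ind=> [|z IH]; first by rewrite mmulx0 !maddx0.
by rewrite maddxS !mmulxS IH maddA.
Qed.
Lemma mmulA x y z : x * (y * z) = (x * y) * z.
Proof.
move: z; ind=> [|z IH]; first by rewrite !mmulx0.
by rewrite !mmulxS mmulDr IH.
Qed.
Lemma mmul1x x : 𝟏 * x = x.
Proof. by rewrite -[X in X * _]madd0x mmulSx mmul0x madd0x. Qed.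

Lemma msemiring : @semi_ring_theory (dom M) 𝟎 𝟏 (@madd _) (@mmul _) eq.
Proof.
split.
- exact: madd0x.
- exact: maddC.
- exact: maddA.
- exact: mmul1x.
- exact: mmul0x.
- exact: mmulC.
- exact: mmulA.
- by move=> x y z; rewrite mmulC mmulDr !(mmulC z).
Qed.
Add Ring dom_ring : msemiring.

Lemma maddI x y z : x + z = y + z -> x = y.
Proof.
move: z; ind=> [|z IH]; first by rewrite !maddx0.
by rewrite !maddxS => /madd1_inj.
Qed.

Lemma mS_exists x : x = 𝟎 \/ exists y, x = y + 𝟏.
Proof.
have [|||y H] := @sigma1_ind _ HM (fun x y => x = 𝟎 \/ x = y + 𝟏) _ _ _ x.
- by def.
- by exists 𝟎; left.
- by move=> z _; exists z; right.
- by case: H => ->; [left | right; exists y].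
Qed.

Lemma mlt_add x k : x < x + (k + 𝟏).
Proof.
move: k; ind=> [|k IH]; first by rewrite madd0x; apply/mltxS; right.
by rewrite maddxS; apply/mltxS; left.
Qed.

Lemma mltP x y : x < y <-> exists k, y = x + (k + 𝟏).
Proof.
split=> [|[k ->]]; last exact: mlt_add.
have [|||k Hk] := @sigma1_ind _ HM (fun y k => x < y -> y = x + (k + 𝟏)) _ _ _ y.
- by def.
- by exists 𝟎 => /mltx0.
- move=> z [k Hk]; case: (classic (x < z)) => [/Hk E|H].
    by exists (k + 𝟏) => _; rewrite [X in X + _]E; ring.
  by exists 𝟎 => /mltxS [//|->]; rewrite madd0x.
- by move=> /Hk E; exists k.
Qed.

Lemma mlt_total x y : x < y \/ x = y \/ y < x.
Proof.
move: y; ind.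
  have [->|[y ->]] := mS_exists x; first by right; left.
  by right; right; apply/mltP; exists y; rewrite madd0x.
move=> y [H|[->|/mltP [k ->]]].
- by left; apply/mltxS; left.
- by left; apply/mltxS; right.
- have [->|[j ->]] := mS_exists k; first by right; left; ring.
  by right; right; apply/mltP; exists j; ring.
Qed.

Lemma mlt_irr x : ~ x < x.
Proof.
move=> /mltP [k E]; apply: (@madd1_neq0 k); apply: (@maddI _ _ x).
by rewrite madd0x maddC -E.
Qed.

Lemma mmulI x y z : z <> 𝟎 -> x * z = y * z -> x = y.
Proof.
have aux u k : z <> 𝟎 -> (u + (k + 𝟏)) * z = u * z -> False.
  have [->//|[j ->] _ E] := mS_exists z.
  apply: (@madd1_neq0 (k * (j + 𝟏) + j)); apply: (@maddI _ _ (u * (j + 𝟏))).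
  by rewrite madd0x -[RHS]E; ring.
move=> z0 E; have [/mltP [k Ek]|[//|/mltP [k Ek]]] := mlt_total x y.
- by case: (aux x k z0); rewrite -Ek.
- by case: (aux y k z0); rewrite -Ek.
Qed.

Implicit Types a b : M.
(** The fractions (p - n) / (d + 1) over [M] form an ordered field, so that
    decision procedures for linear arithmetic become available for [M]. *)
Definition frac : Type := (dom M * dom M * dom M)%type.
Definition feqv (a b : frac) : Prop :=
  let '(p, n, d) := a in let '(p', n', d') := b in
  p * (d' + 𝟏) + n' * (d + 𝟏) = p' * (d + 𝟏) + n * (d' + 𝟏).

Lemma feqv_refl (a : frac) : feqv a a.
Proof. by move: a => [[p n] d]; rewrite /feqv. Qed.
Lemma feqv_sym (a b : frac) : feqv a b -> feqv b a.
Proof. by move: a b => [[p n] d] [[p' n'] d']; rewrite /feqv. Qed.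
Lemma feqv_trans (a b c : frac) : feqv a b -> feqv b c -> feqv a c.
Proof.
move: a b c => [[p1 n1] d1] [[p2 n2] d2] [[p3 n3] d3] /= E1 E2.
apply: (mmulI (@madd1_neq0 d2)).
apply: (maddI (z := n2 * (d1 + 𝟏) * (d3 + 𝟏) + p2 * (d1 + 𝟏) * (d3 + 𝟏))).
transitivity ((p1 * (d2 + 𝟏) + n2 * (d1 + 𝟏)) * (d3 + 𝟏)
            + (p2 * (d3 + 𝟏) + n3 * (d2 + 𝟏)) * (d1 + 𝟏)); first by ring.
by rewrite E1 E2; ring.
Qed.

Definition fraction : Type := quot feqv.
Definition fcls (a : frac) : fraction := cls feqv a.
Lemma fcls_eq (a b : frac) : fcls a = fcls b <-> feqv a b.
Proof. exact: (cls_eq feqv_refl feqv_sym feqv_trans). Qed.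
Lemma fcls_rep (x : fraction) : fcls (rep x) = x.
Proof. exact: cls_rep. Qed.
Lemma fracW (P : fraction -> Prop) :
  (forall p n d, P (fcls (p, n, d))) -> forall x : fraction, P x.
Proof. by move=> H x; rewrite -(fcls_rep x); case: (rep x) => [[]]. Qed.

Definition fadd0 (a b : frac) : frac :=
  let '(p, n, d) := a in let '(p', n', d') := b in
  (p * (d' + 𝟏) + p' * (d + 𝟏), n * (d' + 𝟏) + n' * (d + 𝟏), d * d' + d + d').
Definition fmul0 (a b : frac) : frac :=
  let '(p, n, d) := a in let '(p', n', d') := b in
  (p * p' + n * n', p * n' + n * p', d * d' + d + d').
Definition fopp0 (a : frac) : frac := let '(p, n, d) := a in (n, p, d).

Definition fadd (x y : fraction) := fcls (fadd0 (rep x) (rep y)).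
Definition fmul (x y : fraction) := fcls (fmul0 (rep x) (rep y)).
Definition fopp (x : fraction) := fcls (fopp0 (rep x)).
Definition fnat (a : M) : fraction := fcls (a, 𝟎, 𝟎).

Lemma feqv_rep (a : frac) : feqv (rep (fcls a)) a.
Proof. by apply/fcls_eq; apply: fcls_rep. Qed.

Lemma faddE (a b : frac) : fadd (fcls a) (fcls b) = fcls (fadd0 a b).
Proof.
apply/fcls_eq; move: (feqv_rep a) (feqv_rep b).
case: a => [[p1 n1] d1]; case: b => [[p2 n2] d2].
case: (rep _) => [[p3 n3] d3]; case: (rep _) => [[p4 n4] d4] /= E1 E2.
transitivity ((p3 * (d1 + 𝟏) + n1 * (d3 + 𝟏)) * ((d4 + 𝟏) * (d2 + 𝟏))
            + (p4 * (d2 + 𝟏) + n2 * (d4 + 𝟏)) * ((d3 + 𝟏) * (d1 + 𝟏))).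
  by ring.
by rewrite E1 E2; ring.
Qed.

Lemma fmul0_compat (a a' b : frac) : feqv a a' -> feqv (fmul0 a b) (fmul0 a' b).
Proof.
move: a a' b => [[p1 n1] d1] [[p2 n2] d2] [[p n] d] /= E.
transitivity ((p1 * (d2 + 𝟏) + n2 * (d1 + 𝟏)) * (p * (d + 𝟏))
            + (p2 * (d1 + 𝟏) + n1 * (d2 + 𝟏)) * (n * (d + 𝟏))); first by ring.
by rewrite E -[in X in _ + X]E; ring.
Qed.
Lemma fmul0C (a b : frac) : fmul0 a b = fmul0 b a.
Proof.
by move: a b => [[p1 n1] d1] [[p2 n2] d2] /=; congr (_, _, _); ring.
Qed.
Lemma fmulE (a b : frac) : fmul (fcls a) (fcls b) = fcls (fmul0 a b).
Proof.
apply/fcls_eq; apply: feqv_trans (fmul0_compat _ (feqv_rep a)) _.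
by rewrite ![fmul0 a _]fmul0C; apply: fmul0_compat; apply: feqv_rep.
Qed.
Lemma foppE (a : frac) : fopp (fcls a) = fcls (fopp0 a).
Proof.
apply/fcls_eq; move: (feqv_rep a).
case: a => [[p1 n1] d1]; case: (rep _) => [[p3 n3] d3] /= E.
by rewrite maddC -E maddC.
Qed.

Ltac frac := do ?[elim/fracW=> ? ? ?]; rewrite ?/fnat ?(faddE, fmulE, foppE);
  apply/fcls_eq => /=; ring.

Lemma faddA : forall x y z : fraction, fadd x (fadd y z) = fadd (fadd x y) z.
Proof. by frac. Qed.
Lemma faddC : forall x y : fraction, fadd x y = fadd y x.
Proof. by frac. Qed.
Lemma fadd0x : forall x : fraction, fadd (fnat 𝟎) x = x.
Proof. by frac. Qed.
Lemma faddNx : forall x : fraction, fadd (fopp x) x = fnat 𝟎.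
Proof. by frac. Qed.
Lemma fmulA : forall x y z : fraction, fmul x (fmul y z) = fmul (fmul x y) z.
Proof. by frac. Qed.
Lemma fmulC : forall x y : fraction, fmul x y = fmul y x.
Proof. by frac. Qed.
Lemma fmul1x : forall x : fraction, fmul (fnat 𝟏) x = x.
Proof. by frac. Qed.
Lemma fmulDl : forall x y z : fraction, fmul (fadd x y) z = fadd (fmul x z) (fmul y z).
Proof. by frac. Qed.
Lemma fnatD a b : fnat (a + b) = fadd (fnat a) (fnat b).
Proof. by frac. Qed.
Lemma fnatM a b : fnat (a * b) = fmul (fnat a) (fnat b).
Proof. by frac. Qed.
Lemma fnatI a b : fnat a = fnat b -> a = b.
Proof.
move/fcls_eq => /= E; apply: (mmulI (@madd1_neq0 𝟎)).
by apply: (maddI (z := 𝟎 * (𝟎 + 𝟏))).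
Qed.

Lemma frac_cases (x : fraction) : x = fnat 𝟎
  \/ exists k d, x = fcls (k + 𝟏, 𝟎, d) \/ x = fcls (𝟎, k + 𝟏, d).
Proof.
move: x; elim/fracW => p n d.
case: (mlt_total n p) => [/mltP [k ->]|[->|/mltP [k ->]]].
- by right; exists k, d; left; apply/fcls_eq => /=; ring.
- by left; apply/fcls_eq => /=; ring.
- by right; exists k, d; right; apply/fcls_eq => /=; ring.
Qed.

Lemma finv_exists (x : fraction) : x <> fnat 𝟎 -> exists y : fraction, fmul y x = fnat 𝟏.
Proof.
case: (frac_cases x) => [//|[k [d [->|->]]] _].
- by exists (fcls (d + 𝟏, 𝟎, k)); frac.
- by exists (fcls (𝟎, d + 𝟏, k)); frac.
Qed.

Definition fnneg (x : fraction) := exists k d, x = fcls (k, 𝟎, d).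

Lemma fnneg_add (x y : fraction) : fnneg x -> fnneg y -> fnneg (fadd x y).
Proof.
move=> [a [d ->]] [b [e ->]].
by exists (a * (e + 𝟏) + b * (d + 𝟏)), (d * e + d + e); frac.
Qed.
Lemma fnneg_mul (x y : fraction) : fnneg x -> fnneg y -> fnneg (fmul x y).
Proof.
by move=> [a [d ->]] [b [e ->]]; exists (a * b), (d * e + d + e); frac.
Qed.
Lemma fnneg_total (x : fraction) : fnneg x \/ fnneg (fopp x).
Proof.
case: (frac_cases x) => [->|[k [d [->|->]]]].
- by left; exists 𝟎, 𝟎.
- by left; exists (k + 𝟏), d.
- by right; exists (k + 𝟏), d; frac.
Qed.
Lemma fnneg_anti (x : fraction) : fnneg x -> fnneg (fopp x) -> x = fnat 𝟎.
Proof.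
move=> [a [d ->]] [b [e]]; rewrite foppE => /fcls_eq /= E.
have [->|[k Ek]] := mS_exists a; first by frac.
case: (@madd1_neq0 (k * (e + 𝟏) + e + b * (d + 𝟏))); symmetry.
transitivity (𝟎 * (e + 𝟏) + 𝟎 * (d + 𝟏)); first by ring.
by rewrite E Ek; ring.
Qed.

Lemma fnat_lt a b : a < b -> exists k, fnat b = fadd (fadd (fnat a) (fnat k)) (fnat 𝟏).
Proof. by move=> /mltP [k ->]; exists k; frac. Qed.

Lemma fnat_nneg a : fnneg (fnat a).
Proof. by exists a, 𝟎. Qed.

End Arithmetic.

From HB Require Import structures.
From mathcomp Require Import ssrfun ssrbool eqtype choice order ssralg ssrnum.
From mathcomp Require Import boolp ring lra.
Import Order.TTheory GRing.Theory Num.Theory.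

(** * The ordered field of fractions *)

Section FractionField.
Variable M : rca_model.

HB.instance Definition _ := gen_eqMixin (fraction M).
HB.instance Definition _ := gen_choiceMixin (fraction M).
HB.instance Definition _ := GRing.isZmodule.Build (fraction M)
  (@faddA M) (@faddC M) (@fadd0x M) (@faddNx M).

Lemma fnat1_neq0 : fnat (M := M) 𝟏 != fnat (M := M) 𝟎.
Proof.
apply/eqP => /fnatI E; apply: (@madd1_neq0 M 𝟎).
by rewrite madd0x.
Qed.

HB.instance Definition _ := GRing.Zmodule_isComNzRing.Build (fraction M)
  (@fmulA M) (@fmulC M) (@fmul1x M) (@fmulDl M) fnat1_neq0.

Definition finv (x : fraction M) : fraction M :=
  epsilon (inhabits (0 : fraction M)%R)
    (fun y : fraction M => (x <> 0 -> y * x = 1)%R /\ (x = 0 -> y = 0)%R).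

Lemma finvP (x : fraction M) : (x <> 0 -> finv x * x = 1)%R /\ (x = 0 -> finv x = 0)%R.
Proof.
apply: (epsilon_spec _ (fun y : fraction M => (x <> 0 -> y * x = 1)%R /\ (x = 0 -> y = 0)%R)).
have [->|/eqP x0] := eqVneq x 0%R; first by exists 0%R.
by have [y Hy] := finv_exists x0; exists y.
Qed.

Lemma fmulVf (x : fraction M) : (x != 0 -> finv x * x = 1)%R.
Proof. by move/eqP; apply: (finvP x).1. Qed.
Lemma finv0 : finv 0%R = 0%R.
Proof. exact: (finvP _).2. Qed.

HB.instance Definition _ :=
  GRing.ComNzRing_isField.Build (fraction M) fmulVf finv0.

Definition fleb (x y : fraction M) : bool := `[< fnneg (y - x)%R >].
Definition fnorm (x : fraction M) : fraction M := if fleb 0%R x then x else (- x)%R.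

Lemma fle0 (x : fraction M) : fleb 0%R x = `[< fnneg x >].
Proof. by rewrite /fleb subr0. Qed.

Lemma fle0_add x y : fleb 0%R x -> fleb 0%R y -> fleb 0%R (x + y)%R.
Proof. by rewrite !fle0 => /asboolP Hx /asboolP Hy; apply/asboolP/fnneg_add. Qed.
Lemma fle0_mul x y : fleb 0%R x -> fleb 0%R y -> fleb 0%R (x * y)%R.
Proof. by rewrite !fle0 => /asboolP Hx /asboolP Hy; apply/asboolP/fnneg_mul. Qed.
Lemma fle0_anti x : fleb 0%R x -> fleb x 0%R -> x = 0%R.
Proof.
rewrite fle0 /fleb sub0r => /asboolP Hx /asboolP Hy; exact: fnneg_anti.
Qed.
Lemma fsub_ge0 x y : fleb 0%R (y - x)%R = fleb x y.
Proof. by rewrite fle0. Qed.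
Lemma fle0_total x : fleb 0%R x || fleb x 0%R.
Proof.
rewrite fle0 /fleb sub0r; apply/orP.
by case: (fnneg_total x) => H; [left | right]; apply/asboolP.
Qed.
Lemma fge0_norm x : fleb 0%R x -> fnorm x = x.
Proof. by rewrite /fnorm => ->. Qed.
Lemma fnormN x : fnorm (- x)%R = fnorm x.
Proof.
rewrite /fnorm opprK -[fleb 0%R (- x)%R]/(`[< fnneg (- x - 0)%R >]) subr0.
case: asboolP => H1; rewrite fle0; case: asboolP => H2 //.
  have -> : x = 0%R by apply: fnneg_anti.
  by rewrite oppr0.
by case: (fnneg_total x).
Qed.

HB.instance Definition _ := Num.IntegralDomain_isLeReal.Build (fraction M)
  fle0_add fle0_mul fle0_anti fsub_ge0 fle0_total fnormN fge0_norm
  (fun _ _ => erefl).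

Implicit Types a b : M.
Definition qn a : fraction M := fnat a.

Lemma qnD a b : qn (a + b) = (qn a + qn b)%R.
Proof. exact: fnatD. Qed.
Lemma qnM a b : qn (a * b) = (qn a * qn b)%R.
Proof. exact: fnatM. Qed.
Lemma qn0 : qn 𝟎 = 0%R. Proof. by []. Qed.
Lemma qn1 : qn 𝟏 = 1%R. Proof. by []. Qed.
Lemma qn_ge0 a : (0 <= qn a)%R.
Proof. by rewrite -[(_ <= _)%R]/(fleb 0%R (qn a)) fle0; apply/asboolP/fnat_nneg. Qed.
Lemma qn_eq a b : a = b <-> qn a = qn b.
Proof. by split=> [->//|/fnatI]. Qed.

(** The gap 1 retains the discreteness of the order of [M], which linear arithmetic over an ordered
    field would otherwise lose. *)
Lemma qn_lt a b : a < b <-> (qn a + 1 <= qn b)%R.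
Proof.
have lt c d : c < d -> (qn c + 1 <= qn d)%R.
  move=> /fnat_lt [k]; rewrite -/(qn d) -/(qn c) => E.
  have {}E : (qn d = qn c + qn k + 1)%R by [].
  by have := qn_ge0 k; lra.
split=> [/lt //|H].
case: (mlt_total a b) => [//|[E|/lt L]]; exfalso; last by lra.
by move: H; rewrite E {E}; lra.
Qed.
Lemma qn_nlt a b : ~ a < b <-> (qn b <= qn a)%R.
Proof.
split=> H; last by move/qn_lt=> K; lra.
case: (mlt_total a b) => [//|[->|/qn_lt L]]; first by lra.
lra.
Qed.
Lemma qn_le a b : a <= b <-> (qn a <= qn b)%R.
Proof.
split=> [[/qn_lt H|->]|]; [lra | lra | move=> H].
case: (mlt_total a b) => [|[]]; [by left | by right | move/qn_lt => K].
by exfalso; lra.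
Qed.
Lemma qn_nle a b : ~ a <= b <-> (qn b + 1 <= qn a)%R.
Proof.
split=> H; last by move/qn_le=> K; lra.
case: (mlt_total a b) => [K|[K|/qn_lt //]]; case: H; [by left|by right].
Qed.

Definition qnE := (qnD, qnM, qn0, qn1).

End FractionField.

Ltac qn_hyps := repeat match goal with
  | H : mlt _ _ |- _ => move/qn_lt: H; rewrite ?qnE => H
  | H : mle _ _ |- _ => move/qn_le: H; rewrite ?qnE => H
  | H : ~ mlt _ _ |- _ => move/qn_nlt: H; rewrite ?qnE => H
  | H : ~ mle _ _ |- _ => move/qn_nle: H; rewrite ?qnE => H
  | H : @eq (dom _) _ _ |- _ => move/qn_eq: H; rewrite ?qnE => H
  end.
Ltac qn_atoms := repeat match goal with
  | _ : context [qn ?a] |- _ =>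
    lazymatch goal with _ : is_true (0 <= qn a)%R |- _ => fail | _ => idtac end;
    have := qn_ge0 a; move=> ?
  | |- context [qn ?a] =>
    lazymatch goal with _ : is_true (0 <= qn a)%R |- _ => fail | _ => idtac end;
    have := qn_ge0 a; move=> ?
  end.
Ltac clear_other := repeat match goal with
  | H : @eq ?T _ _ |- _ =>
    lazymatch T with fraction _ => fail | _ => clear H end
  end.
Ltac to_frac :=
  intros; try match goal with
  | |- mlt _ _ => apply/qn_lt
  | |- mle _ _ => apply/qn_le
  | |- @eq (dom _) _ _ => apply/qn_eq
  | |- ~ _ => move=> ?
  end;
  qn_hyps; rewrite ?qnE; clear_other; qn_atoms.
Ltac mlra := to_frac; lra.
Ltac mnra := to_frac; nra.
Ltac mring := apply/qn_eq; rewrite ?qnE; ring.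

(** * Coding in a model of RCA_0 *)

Definition mpr (M : model) (x y : M) : M := (x + y) * (x + y) + x.
Notation "⟨ x , .. , y , z ⟩" := (mpr x .. (mpr y z) ..) : dom_scope.

Section Coding.
Variable M : rca_model.
Let HM : models RCA0 M := @rca_modelP M.
Let X0 : sets M := @rca_set M.
Implicit Types x y z u w a b c d e m n : M.

Lemma mle_sq x : x <= x * x.
Proof.
have [->|[y ->]] := mS_exists x; first by mlra.
by mnra.
Qed.

Lemma mmul_gt0 x y : 𝟎 < x -> 𝟎 < y -> 𝟎 < x * y.
Proof.
have [->|[a ->]] := mS_exists x; first by move/mlt_irr.
have [->|[b ->]] := mS_exists y; first by move=> _ /mlt_irr.
by have := mulr_ge0 (qn_ge0 a) (qn_ge0 b) => H _ _; mlra.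
Qed.

Lemma mpr_lt x y x' y' : x + y < x' + y' -> ⟨x, y⟩ < ⟨x', y'⟩.
Proof. by move=> H; rewrite /mpr; mnra. Qed.

Lemma mpr_inj x y x' y' : ⟨x, y⟩ = ⟨x', y'⟩ -> x = x' /\ y = y'.
Proof.
move=> E; case: (mlt_total (x + y) (x' + y')) => [/mpr_lt H|[S|/mpr_lt H]].
- by exfalso; move: H; rewrite E; apply: mlt_irr.
- have Ex : x = x' by move: E; rewrite /mpr S => E; mlra.
  by split=> //; mlra.
- by exfalso; move: H; rewrite E; apply: mlt_irr.
Qed.

Lemma mpr_ge1 x y : x <= ⟨x, y⟩.
Proof. by have := mle_sq (x + y); rewrite /mpr => H; mlra. Qed.
Lemma mpr_ge2 x y : y <= ⟨x, y⟩.
Proof. by have := mle_sq (x + y); rewrite /mpr => H; mlra. Qed.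
Lemma mpr_mono x y x' y' : x <= x' -> y <= y' -> ⟨x, y⟩ <= ⟨x', y'⟩.
Proof. by rewrite /mpr => H K; mnra. Qed.
Lemma mpr00 : ⟨𝟎, 𝟎⟩ = 𝟎 :> M.
Proof. by rewrite /mpr; mring. Qed.

(** A form of the least number principle for Pi^0_1-properties that includes
    a bound on the witnesses against the smaller numbers. *)
Lemma least_pi1 (G : M -> M -> Prop) : Def (fun v => G (v 0) (v 1)) ->
  (exists w, forall z, G w z) ->
  exists w b, (forall z, G w z) /\ forall w', w' < w -> exists z, z < b /\ ~ G w' z.
Proof.
move=> HG [w0 Hw0]; apply: NNPP => no.
(* Without a least element, Sigma_1-induction on w refutes all smaller numbers below a common bound
   [b]: if w itself were never refuted, it would be the least element sought. Beyond [w0] this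
   contradicts the choice of [w0]. *)
have [|||b /(_ w0)] := @sigma1_ind _ HM
  (fun w b => forall w', w' < w -> exists z, z < b /\ ~ G w' z) _ _ _ (w0 + 𝟏).
- by def.
- by exists 𝟎 => w' /mltx0.
- move=> w [b Hb]; case: (pselect (forall z, G w z)) => [Hw|/not_all_ex_not [z Hz]].
    by case: no; exists w, b.
  exists (b + z + 𝟏) => w' /mltxS [/Hb [y [yb Hy]]|->].
    by exists y; split=> //; mlra.
  by exists z; split=> //; mlra.
- by case=> [|z [_]]; [mlra | apply; apply: Hw0].
Qed.

(** The bound on the quotient makes divisibility Delta_0 and is no restriction for positive [a].
    Together with [modulus] this is the membership relation of [mfin_mem]. *)
Definition mdvd a d := exists c, c < d + 𝟏 /\ a * c = d.
Definition modulus m u := m * (u + 𝟏) + 𝟏.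

Lemma mdvdI a c : 𝟎 < a -> mdvd a (a * c).
Proof. by move=> a0; exists c; split=> //; mnra. Qed.


Lemma mdvd_trans a b c : mdvd a b -> mdvd b c -> 𝟎 < c -> mdvd a c.
Proof.
move=> [x [_ <-]] [y [_ <-]] H; exists (x * y); split; last by mring.
have [Ea|[k Ek]] := mS_exists a; last by rewrite Ek; mnra.
by exfalso; rewrite Ea in H; mlra.
Qed.

(** Replaces the divisibility of a difference of multiples, as [M] has no subtraction. *)
Lemma mdvd_diff a e p q : 𝟎 < a -> a * p = e + a * q -> mdvd a e.
Proof.
move=> a0 E; case: (mlt_total p q) => [/mltP [k Ek]|[Ek|/mltP [k Ek]]].
- exfalso; rewrite Ek in E; have := mulr_ge0 (qn_ge0 a) (qn_ge0 k) => H.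
  by mlra.
- rewrite Ek in E; have Ee : e = a * 𝟎 by mlra.
  by rewrite Ee; apply: mdvdI.
- rewrite Ek in E; have Ee : e = a * (k + 𝟏) by mlra.
  by rewrite Ee; apply: mdvdI.
Qed.

Lemma modulus_gt0 m u : 𝟎 < modulus m u.
Proof. by rewrite /modulus; mnra. Qed.

Section Moduli.
Variables U m : M.
Hypothesis m_gt0 : 𝟎 < m.
Hypothesis m_dvd : forall k, k < U -> mdvd (k + 𝟏) m.

(** With [k = |u - v|] and [m = k c], 1 is a combination of [modulus m u] and
    [modulus m v], as [k] is one and [modulus m u = m (u + 1) + 1]. *)
Lemma modulus_coprime u v e : u < U -> v < U -> u <> v ->
  mdvd (modulus m u) (modulus m v * e) -> mdvd (modulus m u) e.
Proof.
move=> uU vU uv [f [_ Ef]]; have a0 := modulus_gt0 m u.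
case: (mlt_total u v) => [/mltP [k Ek]|[//|/mltP [k Ek]]].
- have /m_dvd [c [_ Ec]] : k < U by mlra.
  apply: (mdvd_diff (p := e + (u + 𝟏) * (u + 𝟏) * c * f)
                    (q := (u + 𝟏) * c * (v + 𝟏) * e) a0).
  transitivity (modulus m u * e + (u + 𝟏) * (u + 𝟏) * c * (modulus m u * f)).
    by mring.
  by rewrite Ef /modulus -Ec Ek; mring.
- have /m_dvd [c [_ Ec]] : k < U by mlra.
  apply: (mdvd_diff (p := e + (u + 𝟏) * c * (v + 𝟏) * e)
                    (q := (u + 𝟏) * (u + 𝟏) * c * f) a0).
  transitivity (e + (u + 𝟏) * (u + 𝟏) * c * (modulus m u * f)); last by mring.
  by rewrite Ef /modulus -Ec Ek; mring.
Qed.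

Variable D : M.
Hypothesis D_gt0 : 𝟎 < D.
Hypothesis D_dvd : forall u, u < U -> mdvd (modulus m u) D.

(** This is bounded Sigma_1-comprehension. The code is the least positive d divisible by the moduli
    of all members, a Pi_1-condition on d that [D] satisfies. If the modulus of a non-member divided
    d, then by coprimality the quotient would satisfy the condition as well and be smaller. *)
Lemma code_set (A : M -> M -> Prop) : Def (fun v => A (v 0) (v 1)) ->
  exists d, 𝟎 < d /\ d <= D
    /\ forall u, u < U -> (mdvd (modulus m u) d <-> exists z, A u z).
Proof.
move=> HA.
pose G d z := 𝟎 < d /\ forall u, u < U -> A u z -> mdvd (modulus m u) d.
have [||d [b [Hd min_d]]] := @least_pi1 G.
- by rewrite /G /mdvd /modulus; def.
- by exists D => z; split=> // u /D_dvd.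
have d0 : 𝟎 < d by case: (Hd 𝟎).
exists d; split=> //; split.
  case: (pselect (d <= D)) => // H; have /min_d [z [_ []]] : D < d by mlra.
  by split=> // u /D_dvd.
move=> u uU; split=> [[c [_ Ec]]|[z Az]]; last by have [_] := Hd z; apply.
have c0 : 𝟎 < c.
  have [Ec0|[k ->]] := mS_exists c; last by mlra.
  by exfalso; rewrite Ec0 in Ec; mlra.
have lecd : c < d.
  have H1 := mulr_ge0 (mulr_ge0 (qn_ge0 m) (qn_ge0 u)) (qn_ge0 c).
  have H2 : 𝟎 < m * c by apply: mmul_gt0.
  by rewrite -Ec /modulus; mlra.
apply: NNPP => no; have [z [_]] := min_d c lecd; apply; split=> // u' u'U Az.
apply: (@modulus_coprime u' u c) => //.
  by move=> E; apply: no; exists z; rewrite -E.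
by rewrite Ec; have [_] := Hd z; apply.
Qed.

End Moduli.

Lemma common_multiple (f : M -> M) U : (forall u, 𝟎 < f u) ->
  Def (fun v => mdvd (f (v 0)) (v 1)) ->
  exists e, 𝟎 < e /\ forall u, u < U -> mdvd (f u) e.
Proof.
move=> f0 fD.
have [|||e He] := @sigma1_ind _ HM
  (fun n e => 𝟎 < e /\ forall u, u < n -> mdvd (f u) e) _ _ _ U.
- by def; apply: (Def_comp2 (P := fun u e => mdvd (f u) e) fD); def.
- by exists 𝟏; split=> [|u /mltx0] //; mlra.
- move=> n [e [e0 He]]; exists (e * f n).
  have e1 : 𝟎 < e * f n by apply: mmul_gt0.
  split=> // u /mltxS [/He H|->].
    by apply: mdvd_trans H _ e1; apply: mdvdI.
  by rewrite mmulC; apply: mdvdI.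
- by exists e.
Qed.

Lemma moduli_exist U : exists m D,
  [/\ 𝟎 < m, forall k, k < U -> mdvd (k + 𝟏) m,
      𝟎 < D & forall u, u < U -> mdvd (modulus m u) D].
Proof.
have [||m [m0 Hm]] := @common_multiple (fun k => k + 𝟏) U.
- by move=> u; mlra.
- by rewrite /mdvd; def.
have [||D [D0 HD]] := @common_multiple (modulus m) U.
- exact: modulus_gt0.
- by rewrite /mdvd /modulus; def.
by exists m, D.
Qed.

(** The induction is over the size [k], for all relations on [n + 1] that have
    a code up to [D]. *)
Lemma pigeonhole (R : M -> M -> Prop) n : Def (fun v => R (v 0) (v 1)) ->
  (forall i, i < n + 𝟏 -> exists j, j < n /\ R i j) ->
  (forall i i' j, i < n + 𝟏 -> i' < n + 𝟏 -> j < n -> R i j -> R i' j -> i = i') ->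
  False.
Proof.
move=> HR totR injR; pose U := ⟨n + 𝟏, n + 𝟏⟩ + 𝟏.
have [m [D [m0 mU D0 DU]]] := moduli_exist U.
have prU i j : i < n + 𝟏 -> j < n + 𝟏 -> ⟨i, j⟩ < U.
  move=> Hi Hj; have : ⟨i, j⟩ <= ⟨n + 𝟏, n + 𝟏⟩ by apply: mpr_mono; left.
  by rewrite /U; move: (⟨i, j⟩) => p H; mlra.
pose Rd d i j := mdvd (modulus m ⟨i, j⟩) d.
pose bad k d := (forall i, i < k + 𝟏 -> exists j, j < k /\ Rd d i j) /\
  (forall i, i < k + 𝟏 -> forall i', i' < k + 𝟏 -> forall j, j < k ->
     Rd d i j -> Rd d i' j -> i = i').
(* Any definable counterexample of size [k] has a code up to [D]. As [D] does not depend on [k], the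
   absence of counterexamples is a Delta_0-property of [k]. *)
have code k (R' : M -> M -> Prop) : k <= n -> Def (fun v => R' (v 0) (v 1)) ->
    (forall i, i < k + 𝟏 -> exists j, j < k /\ R' i j) ->
    (forall i, i < k + 𝟏 -> forall i', i' < k + 𝟏 -> forall j, j < k ->
       R' i j -> R' i' j -> i = i') -> exists d, d < D + 𝟏 /\ bad k d.
  move=> kn HR' tot inj.
  have [|d [_ [dD Hd]]] := code_set m0 mU D0 DU (A := fun u _ =>
    exists i, i < k + 𝟏 /\ exists j, j < k /\ (u = ⟨i, j⟩ /\ R' i j)).
    by rewrite /mpr; def; apply: (Def_comp2 HR'); def.
  have E i j : i < k + 𝟏 -> j < k -> (Rd d i j <-> R' i j).
    move=> ik jk; rewrite /Rd Hd; last by apply: prU; mlra.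
    split=> [[_ [i' [_ [j' [_ [/mpr_inj [-> ->]]]]]]] //|H].
    by exists 𝟎, i; split=> //; exists j.
  exists d; split; first by mlra.
  split=> [i ik|i ik i' i'k j jk].
    by have [j [jk /E H]] := tot i ik; exists j; split=> //; apply: H.
  by rewrite !E //; apply: inj.
have [||d [dD bd]] := code n R _ HR totR.
- by right.
- by move=> i ik i' i'k j jk; apply: injR.
have none k : k <= n -> forall d, d < D + 𝟏 -> ~ bad k d.
  move: k; refine (bounded_ind HM _ _ _).
  - by rewrite /bad /Rd /mdvd /modulus /mpr; def.
  - by move=> _ e _ [/(_ 𝟎) [|j [/mltx0]]] //; mlra.
  - move=> k IH kn e eD [tot inj]; have kn' : k <= n by mlra.
    (* Removal of the last hole k and the last pigeon k + 1: a pigeon sitting in hole k moves to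
       where pigeon k + 1 sits. By injectivity, the latter is then in a hole below k that no other
       pigeon uses. *)
    have [||||d' [d'D]] := code k (fun i j => Rd e i j \/ Rd e i k /\ Rd e (k + 𝟏) j).
    + by [].
    + by rewrite /Rd /mdvd /modulus /mpr; def.
    + move=> i ik; have [|j [/mltxS [jk|->] Hj]] := tot i; first by mlra.
        by exists j; split=> //; left.
      have [|j' [/mltxS [jk|E] Hj']] := tot (k + 𝟏); first by mlra.
        by exists j'; split=> //; right.
      rewrite E in Hj'; have : i = k + 𝟏 by apply: (inj i _ _ _ k) => //; mlra.
      by move=> Ei; exfalso; mlra.
    + have aux i j : i < k + 𝟏 -> j < k -> Rd e i j -> Rd e (k + 𝟏) j -> False.
        move=> ik jk H1 H2; have : i = k + 𝟏 by apply: (inj i _ _ _ j) => //; mlra.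
        by move=> Ei; mlra.
      move=> i ik i' i'k j jk [H1|[H1 H2]] [H3|[H3 H4]].
      * by apply: (inj i _ i' _ j) => //; mlra.
      * by case: (aux i j).
      * by case: (aux i' j).
      * by apply: (inj i _ i' _ k) => //; mlra.
    by apply: IH.
by apply: (none n _ d) => //; right.
Qed.

End Coding.

(** * The concrete formulas in a model *)

Section SatLemmas.
Variable M : model.
Variables (v : nat -> M) (V : nat -> sets M).

Lemma sat_imp p q P Q : (sat v V p <-> P) -> (sat v V q <-> Q) ->
  (sat v V (FImp p q) <-> (P -> Q)).
Proof. by move=> /= -> ->. Qed.
Lemma sat_and p q P Q : (sat v V p <-> P) -> (sat v V q <-> Q) ->
  (sat v V (FAnd p q) <-> P /\ Q).
Proof. by move=> /= -> ->; tauto. Qed.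
Lemma sat_or p q P Q : (sat v V p <-> P) -> (sat v V q <-> Q) ->
  (sat v V (FOr p q) <-> P \/ Q).
Proof. by move=> /= -> ->; tauto. Qed.
Lemma sat_iff p q P Q : (sat v V p <-> P) -> (sat v V q <-> Q) ->
  (sat v V (FIff p q) <-> (P <-> Q)).
Proof. by move=> /= -> ->; tauto. Qed.
Lemma sat_all p (P : M -> Prop) : (forall a, sat (a .: v) V p <-> P a) ->
  (sat v V (FAll p) <-> forall a, P a).
Proof. by move=> H; split=> K a; apply/H. Qed.
Lemma sat_allS p (P : sets M -> Prop) : (forall X, sat v (X .: V) p <-> P X) ->
  (sat v V (FAllS p) <-> forall X, P X).
Proof. by move=> H; split=> K a; apply/H. Qed.
Lemma sat_ex p (P : M -> Prop) : (forall a, sat (a .: v) V p <-> P a) ->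
  (sat v V (FEx p) <-> exists a, P a).
Proof.
move=> H; split=> [K|[a /H Ha] K]; last exact: (K a Ha).
by apply: NNPP => no; apply: K => a /H Pa; apply: no; exists a.
Qed.
Lemma sat_exS p (P : sets M -> Prop) : (forall X, sat v (X .: V) p <-> P X) ->
  (sat v V (FExS p) <-> exists X, P X).
Proof.
move=> H; split=> [K|[a /H Ha] K]; last exact: (K a Ha).
by apply: NNPP => no; apply: K => a /H Pa; apply: no; exists a.
Qed.
Lemma sat_bex t p a (P : M -> Prop) :
  (forall x, eval (x .: v) t = a) -> (forall x, sat (x .: v) V p <-> P x) ->
  (sat v V (FNeg (FAll (FImp (FLt (TVar 0) t) (FNeg p))))
   <-> exists x, x < a /\ P x).
Proof.
move=> Ht Hp; split=> [K|[x [xa /Hp Px]] K]; last first.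
  by apply: (K x) Px; rewrite /= Ht.
apply: NNPP => no; apply: K => x; rewrite /= Ht => xa /Hp Px.
by apply: no; exists x.
Qed.

End SatLemmas.

(** Proves [sat v V p <-> P] by decomposing [P]; [p] is unfolded by unification. *)
Ltac den :=
  lazymatch goal with
  | |- _ <-> ?P => let P' := eval hnf in P in change P with P'
  end;
  lazymatch goal with
  | |- _ <-> (_ /\ _) => apply: sat_and; den
  | |- _ <-> (_ \/ _) => apply: sat_or; den
  | |- _ <-> (exists x : dom _, x < _ /\ _) =>
      apply: sat_bex => ?; [reflexivity | den]
  | |- _ <-> (exists x : dom _, _) => apply: sat_ex => ?; den
  | |- _ <-> (exists x : sets _, _) => apply: sat_exS => ?; den
  | |- _ <-> (forall x : dom _, _) => apply: sat_all => ?; den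
  | |- _ <-> (forall x : sets _, _) => apply: sat_allS => ?; den
  | |- _ <-> (_ -> _) => apply: sat_imp; den
  | |- _ => reflexivity
  end.

(** The meaning in [M] of the formulas of the same name without [m] *)
Section Mirror.
Variable M : model.
Implicit Types N : M.

Record mrat := MRat { mpos : M; mneg : M; mden : M }.
Definition mcode (a : mrat) : M := ⟨mpos a, mneg a, mden a⟩.
Definition mrdenom (a : mrat) : M := mden a + 𝟏.
Definition mrzero := MRat 𝟎 𝟎 𝟎.
Definition mradd (a b : mrat) : mrat :=
  MRat (mpos a * mrdenom b + mpos b * mrdenom a)
       (mneg a * mrdenom b + mneg b * mrdenom a)
       (mden a * mden b + mden a + mden b).
Definition mrlt (a b : mrat) : Prop :=
  mpos a * mrdenom b + mneg b * mrdenom a < mpos b * mrdenom a + mneg a * mrdenom b.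
Definition mrle (a b : mrat) : Prop :=
  mpos a * mrdenom b + mneg b * mrdenom a <= mpos b * mrdenom a + mneg a * mrdenom b.
Definition mrclose (a b e : mrat) := mrlt a (mradd b e) /\ mrlt b (mradd a e).
Definition mrall (f : mrat -> Prop) := forall p n d, f (MRat p n d).
Definition mrex (f : mrat -> Prop) := exists p n d, f (MRat p n d).
Definition mrseq := M -> mrat -> Prop.
Definition mseq_of_set (X : sets M) : mrseq := fun i a => ⟨i, mcode a⟩ ∈ X.
Definition mseq_of_family (X : sets M) (n : M) : mrseq :=
  fun i a => ⟨⟨n, i⟩, mcode a⟩ ∈ X.
Definition mis_seq (x : mrseq) := forall i, mrex (x i)
  /\ mrall (fun a => mrall (fun b => x i a /\ x i b -> mcode a = mcode b)).
Definition mrpositive e := mrlt mrzero e.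
Definition mcauchy (x : mrseq) := mrall (fun e => mrpositive e ->
  exists N, forall m n, N <= m /\ N <= n ->
    mrall (fun a => mrall (fun b => x m a /\ x n b -> mrclose a b e))).
Definition mreal_seq x := mis_seq x /\ mcauchy x.
Definition mreal (X : sets M) :=
  (forall z, z ∈ X -> exists i, mrex (fun a => z = ⟨i, mcode a⟩))
  /\ mreal_seq (mseq_of_set X).
Definition mfinite_collection N (X : sets M) :=
  (forall z, z ∈ X -> exists n i, n <= N /\ mrex (fun a => z = ⟨⟨n, i⟩, mcode a⟩))
  /\ (forall n, n <= N -> mreal_seq (mseq_of_family X n)).
Definition mreal_le (x y : mrseq) := mrall (fun e => mrpositive e ->
  exists N, forall n, N <= n ->
    mrall (fun a => mrall (fun b => x n a /\ y n b -> mrle a (mradd b e)))).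
Definition mreal_eq x y := mreal_le x y /\ mreal_le y x.
Definition mreal_lt x y := mreal_le x y /\ ~ mreal_eq x y.

Definition no_dense : Prop := forall (N : M) (X : sets M), mfinite_collection N X ->
  exists Y Z, mreal Y /\ mreal Z /\ mreal_lt (mseq_of_set Y) (mseq_of_set Z)
    /\ forall n, n <= N ->
      ~ (mreal_le (mseq_of_set Y) (mseq_of_family X n)
         /\ mreal_le (mseq_of_family X n) (mseq_of_set Z)).

Lemma sat_no_dense v V : sat (M := M) v V no_dense_finite_collection <-> no_dense.
Proof. by den. Qed.

Fixpoint mnum (n : nat) : M := match n with O => 𝟎 | S n => mnum n + 𝟏 end.

Record mfinset := MFinSet { mbound : M; mfmod : M; mfnum : M }.
Definition mfin_mem (z : M) (w : mfinset) := z < mbound w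
  /\ exists c, c < mfnum w + 𝟏 /\ (mfmod w * (z + 𝟏) + 𝟏) * c = mfnum w.

Definition mformation (w : mfinset) :=
  let B := mbound w in
  (forall t, t < B -> mfin_mem ⟨mnum 0, t⟩ w ->
       t = ⟨mnum 1, mnum 0⟩ \/ t = ⟨mnum 2, mnum 0⟩
       \/ (exists k, k < B /\ t = ⟨mnum 0, k⟩)
       \/ (exists u, u < B /\ exists v, v < B /\
             (mfin_mem ⟨mnum 0, u⟩ w /\ mfin_mem ⟨mnum 0, v⟩ w
             /\ (t = ⟨mnum 3, u, v⟩ \/ t = ⟨mnum 4, u, v⟩))))
  /\ (forall p, p < B -> mfin_mem ⟨mnum 1, p⟩ w ->
       p = ⟨mnum 0, mnum 0⟩
       \/ (exists u, u < B /\ exists v, v < B /\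
             (mfin_mem ⟨mnum 0, u⟩ w /\ mfin_mem ⟨mnum 0, v⟩ w
             /\ (p = ⟨mnum 1, u, v⟩ \/ p = ⟨mnum 2, u, v⟩)))
       \/ (exists j, j < B /\ exists u, u < B /\
             (mfin_mem ⟨mnum 0, u⟩ w /\ p = ⟨mnum 3, j, u⟩))
       \/ (exists q, q < B /\ exists r, r < B /\
             (mfin_mem ⟨mnum 1, q⟩ w /\ mfin_mem ⟨mnum 1, r⟩ w /\ p = ⟨mnum 4, q, r⟩))
       \/ (exists u, u < B /\ exists q, q < B /\
             (mfin_mem ⟨mnum 0, u⟩ w /\ mfin_mem ⟨mnum 1, q⟩ w /\ p = ⟨mnum 5, u, q⟩))).

Definition mis_delta0_code (p : M) := exists B m n,
  let w := MFinSet B m n in mformation w /\ mfin_mem ⟨mnum 1, p⟩ w.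

Definition muncons (s x r : M) := s = ⟨x, r⟩
  \/ (x = 𝟎 /\ r = 𝟎
      /\ ~ (exists a, a < s + 𝟏 /\ exists b, b < s + 𝟏 /\ s = ⟨a, b⟩)).

Definition mterm_entry (t s y : M) : M := ⟨mnum 0, t, s, y⟩.
Definition mform_entry (p s b : M) : M := ⟨mnum 1, p, s, b⟩.
Definition mtruth_value (b : M) (P : Prop) := (b = 𝟏 /\ P) \/ (b = 𝟎 /\ ~ P).

Definition mevaluation (w : mfinset) (X : sets M) :=
  let B := mbound w in
  (forall t, t < B -> forall s, s < B -> forall y, y < B ->
     mfin_mem (mterm_entry t s y) w ->
       (exists x, x < s + 𝟏 /\ exists r, r < s + 𝟏 /\ (muncons s x r
           /\ ((t = ⟨mnum 0, mnum 0⟩ /\ y = x)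
               \/ exists k, k < B /\ (t = ⟨mnum 0, k + 𝟏⟩
                             /\ mfin_mem (mterm_entry ⟨mnum 0, k⟩ r y) w))))
       \/ (t = ⟨mnum 1, mnum 0⟩ /\ y = 𝟎)
       \/ (t = ⟨mnum 2, mnum 0⟩ /\ y = 𝟏)
       \/ (exists u, u < B /\ exists v, v < B /\ exists a, a < B /\ exists b, b < B /\
             (mfin_mem (mterm_entry u s a) w /\ mfin_mem (mterm_entry v s b) w
             /\ ((t = ⟨mnum 3, u, v⟩ /\ y = a + b)
                 \/ (t = ⟨mnum 4, u, v⟩ /\ y = a * b)))))
  /\ (forall p, p < B -> forall s, s < B -> forall b, b < B ->
      mfin_mem (mform_entry p s b) w ->
       (p = ⟨mnum 0, mnum 0⟩ /\ mtruth_value b False)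
       \/ (exists u, u < B /\ exists v, v < B /\ exists x, x < B /\ exists y, y < B /\
             (mfin_mem (mterm_entry u s x) w /\ mfin_mem (mterm_entry v s y) w
             /\ ((p = ⟨mnum 1, u, v⟩ /\ mtruth_value b (x = y))
                 \/ (p = ⟨mnum 2, u, v⟩ /\ mtruth_value b (x < y)))))
       \/ (exists j, j < B /\ exists u, u < B /\ exists x, x < B /\
             (mfin_mem (mterm_entry u s x) w
             /\ p = ⟨mnum 3, j, u⟩ /\ mtruth_value b (⟨j, x⟩ ∈ X)))
       \/ (exists q, q < B /\ exists r, r < B /\ exists c, c < B /\ exists d, d < B /\
             (mfin_mem (mform_entry q s c) w /\ mfin_mem (mform_entry r s d) w
             /\ p = ⟨mnum 4, q, r⟩ /\ mtruth_value b (c = 𝟏 -> d = 𝟏)))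
       \/ (exists u, u < B /\ exists q, q < B /\ exists y, y < B /\
             (mfin_mem (mterm_entry u s y) w /\ p = ⟨mnum 5, u, q⟩
             /\ ((b = 𝟏 /\ forall x, x < y -> mfin_mem (mform_entry q ⟨x, s⟩ 𝟏) w)
                 \/ (b = 𝟎 /\ exists x, x < y /\ mfin_mem (mform_entry q ⟨x, s⟩ 𝟎) w))))).

Definition mtrue_delta0 (p s : M) (X : sets M) := forall B m n,
  let w := MFinSet B m n in
  mevaluation w X -> forall b, b < B -> mfin_mem (mform_entry p s b) w -> b = 𝟏.

Definition mtrue_sigma2 (p s : M) (X : sets M) :=
  exists x, forall y, mtrue_delta0 p ⟨y, x, s⟩ X.

Definition minjection_into (N : M) (C : M -> M -> Prop) :=
  (forall i, exists j, C i j)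
  /\ (forall i j, C i j -> j <= N)
  /\ (forall i j k, C i j /\ C i k -> j = k)
  /\ (forall i j k, C i k /\ C j k -> i = j).

Definition cardinality : Prop :=
  ~ exists (N : M) p v (X : sets M), mis_delta0_code p
     /\ minjection_into N (fun i j => mtrue_sigma2 p ⟨i, j, v⟩ X).

Lemma sat_cardinality v V : sat (M := M) v V sigma2_cardinality_principle <-> cardinality.
Proof. by den. Qed.

End Mirror.

(** * Values of coded rationals *)

Section Rationals.
Variable M : rca_model.
Implicit Types (a b e : mrat M).

Definition rval a : fraction M :=
  ((qn (mpos a) - qn (mneg a)) / (qn (mden a) + 1))%R.

Lemma den_gt0 (d : M) : (0 < qn d + 1)%R.
Proof. by have := qn_ge0 d; lra. Qed.
Lemma den_neq0 (d : M) : (qn d + 1 != 0)%R.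
Proof. by apply: lt0r_neq0; apply: den_gt0. Qed.

Lemma mrle_val a b : mrle a b <-> (rval a <= rval b)%R.
Proof.
rewrite /mrle qn_le /mrdenom /rval !qnE.
rewrite ler_pdivrMr ?den_gt0 // mulrAC ler_pdivlMr ?den_gt0 //.
by split=> H; lra.
Qed.
Lemma mrlt_val a b : mrlt a b <-> (rval a < rval b)%R.
Proof.
have -> : mrlt a b <-> ~ mrle b a.
  by rewrite /mrlt /mrle; split=> H; mlra.
rewrite mrle_val; split=> H; last by lra.
by rewrite ltNge; apply/negP.
Qed.
Lemma val_add a b : rval (mradd a b) = (rval a + rval b)%R.
Proof.
rewrite /rval /mradd /mrdenom /= !qnE.
have -> : (qn (mden a) * qn (mden b) + qn (mden a) + qn (mden b) + 1
  = (qn (mden a) + 1) * (qn (mden b) + 1))%R by ring.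
by field; rewrite !den_neq0.
Qed.
Lemma val_zero : rval (mrzero M) = 0%R.
Proof. by rewrite /rval /= subrr mul0r. Qed.

Lemma mrpositive_val e : mrpositive e <-> (0 < rval e)%R.
Proof. by rewrite /mrpositive mrlt_val val_zero. Qed.
Lemma mrclose_val a b e : mrclose a b e <->
  (rval a < rval b + rval e)%R /\ (rval b < rval a + rval e)%R.
Proof. by rewrite /mrclose !mrlt_val !val_add. Qed.
Lemma mrle_add_val a b e : mrle a (mradd b e) <-> (rval a <= rval b + rval e)%R.
Proof. by rewrite mrle_val val_add. Qed.

Lemma mcode_inj a b : mcode a = mcode b -> a = b.
Proof.
case: a b => [p n d] [p' n' d'].
by rewrite /mcode /= => /mpr_inj [-> /mpr_inj [-> ->]].
Qed.

Lemma mrallP (f : mrat M -> Prop) : mrall f <-> forall a, f a.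
Proof. by split=> [H [p n d]|H p n d]; apply: H. Qed.
Lemma mrexP (f : mrat M -> Prop) : mrex f <-> exists a, f a.
Proof. by split=> [[p [n [d H]]]|[[p n d] H]]; [exists (MRat p n d)|exists p, n, d]. Qed.

Lemma val_half e : exists e', (rval e' * 4 = rval e)%R.
Proof.
exists (MRat (mpos e) (mneg e) ((𝟏 + 𝟏 + 𝟏 + 𝟏) * mden e + 𝟏 + 𝟏 + 𝟏)).
rewrite /rval /= !qnE; have := den_neq0 (mden e) => H.
have -> : ((1 + 1 + 1 + 1) * qn (mden e) + 1 + 1 + 1 + 1
  = 4 * (qn (mden e) + 1))%R by ring.
by field; rewrite H.
Qed.

Lemma val_mid a b : exists c, (rval c * 2 = rval a + rval b)%R.
Proof.
have [c Hc] : exists c, (rval c * 2 = rval (mradd a b))%R; last first.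
  by exists c; rewrite Hc val_add.
move: (mradd a b) => e.
exists (MRat (mpos e) (mneg e) ((𝟏 + 𝟏) * mden e + 𝟏)).
rewrite /rval /= !qnE; have := den_neq0 (mden e) => H.
have -> : ((1 + 1) * qn (mden e) + 1 + 1 = 2 * (qn (mden e) + 1))%R by ring.
by field; rewrite H.
Qed.

Lemma mis_seqP (x : mrseq M) :
  mis_seq x <-> forall i, (exists a, x i a) /\ forall a b, x i a -> x i b -> a = b.
Proof.
split=> H i; have [H1 H2] := H i.
  split; first by apply/mrexP.
  move=> a b Ha Hb; apply: mcode_inj.
  by move: H2 => /mrallP /(_ a) /mrallP /(_ b); apply.
split; first by apply/mrexP.
by apply/mrallP => a; apply/mrallP => b [Ha Hb]; congr mcode; apply: H2.
Qed.

End Rationals.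

(** * Cauchy sequences and separation by rationals *)

Section Reals.
Variable M : rca_model.
Implicit Types (a b e : mrat M) (x y : mrseq M).

Lemma mcauchyP x : mcauchy x <-> forall e, (0 < rval e)%R ->
  exists N, forall m n, N <= m -> N <= n -> forall a b, x m a -> x n b ->
  (rval a < rval b + rval e)%R /\ (rval b < rval a + rval e)%R.
Proof.
split=> [/mrallP H e /mrpositive_val /H [N HN]|H].
  exists N => m n Hm Hn a b Ha Hb; apply/mrclose_val.
  by move: (HN m n (conj Hm Hn)) => /mrallP /(_ a) /mrallP /(_ b); apply.
apply/mrallP => e /mrpositive_val /H [N HN]; exists N => m n [Hm Hn].
by apply/mrallP => a; apply/mrallP => b [Ha Hb]; apply/mrclose_val; apply: HN Ha Hb.
Qed.

Lemma mreal_leP x y : mreal_le x y <-> forall e, (0 < rval e)%R ->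
  exists N, forall n, N <= n -> forall a b, x n a -> y n b ->
  (rval a <= rval b + rval e)%R.
Proof.
split=> [/mrallP H e /mrpositive_val /H [N HN]|H].
  exists N => n Hn a b Ha Hb; apply/mrle_add_val.
  by move: (HN n Hn) => /mrallP /(_ a) /mrallP /(_ b); apply.
apply/mrallP => e /mrpositive_val /H [N HN]; exists N => n Hn.
by apply/mrallP => a; apply/mrallP => b [Ha Hb]; apply/mrle_add_val; apply: HN Ha Hb.
Qed.

Lemma eventually_mreal_le x y : (exists N, forall n, N <= n ->
  forall a b, x n a -> y n b -> (rval a <= rval b)%R) -> mreal_le x y.
Proof.
move=> [N HN]; apply/mreal_leP => e e0; exists N => n Hn a b Ha Hb.
by have := HN n Hn a b Ha Hb; lra.
Qed.

(** Since y <= x fails, there is an e > 0 with x_n + e < y_n for arbitrarily late n. One such n at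
    which both sequences are already stable up to e/4 suffices: the midpoint of x_n and y_n
    separates the sequences from then on. *)
Lemma mreal_lt_between x y : mcauchy x -> mcauchy y -> mreal_lt x y ->
  exists c N, forall n, N <= n ->
    (forall a, x n a -> (rval a <= rval c)%R)
    /\ (forall b, y n b -> (rval c <= rval b)%R).
Proof.
move=> /mcauchyP Cx /mcauchyP Cy [lexy neq].
have {neq} : ~ mreal_le y x by move=> H; apply: neq.
move=> /mreal_leP /not_all_ex_not [e He].
have e0 : (0 < rval e)%R by apply: NNPP => H; apply: He.
have [e4 E4] := val_half e; have e40 : (0 < rval e4)%R by lra.
have [N1 H1] := Cx e4 e40; have [N2 H2] := Cy e4 e40.
have {He} : exists n, N1 + N2 <= n /\ exists b a, [/\ y n b, x n a &
    (rval a + rval e < rval b)%R].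
  apply: NNPP => no; apply: He => _; exists (N1 + N2) => n Hn b a Hb Ha.
  rewrite leNgt; apply/negP => lt; apply: no; exists n; split=> //.
  by exists b, a.
move=> [n [Hn [b [a [Hb Ha lt]]]]]; have [c Ec] := val_mid a b.
have Hn1 : N1 <= n by mlra.
have Hn2 : N2 <= n by mlra.
exists c, (N1 + N2) => n' Hn'.
have Hn1' : N1 <= n' by mlra.
have Hn2' : N2 <= n' by mlra.
split=> [a' Ha'|b' Hb'].
  by have [? ?] := H1 n n' Hn1 Hn1' a a' Ha Ha'; lra.
by have [? ?] := H2 n n' Hn2 Hn2' b b' Hb Hb'; lra.
Qed.

Lemma eventually_constant_mcauchy x : (exists N c, forall n, N <= n ->
  forall a, x n a -> a = c) -> mcauchy x.
Proof.
move=> [N [c H]]; apply/mcauchyP => e e0; exists N => m n Hm Hn a b Ha Hb.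
by rewrite (H m Hm a Ha) (H n Hn b Hb); lra.
Qed.

End Reals.

(** * A dense collection from an injection *)

Section Dense.
Variable M : rca_model.
Let HM : models RCA0 M := @rca_modelP M.
Let X0 : sets M := @rca_set M.
Implicit Types i j k m n r s t w z : M.

Variables (psi : M -> M -> M -> M -> Prop) (N : M).
Hypothesis psiD : Def (fun v => psi (v 0) (v 1) (v 2) (v 3)).
Let C i j := exists x, forall z, psi x z i j.
Hypothesis C_inj : minjection_into N C.

(** [E m w] and [F n w]: [w = ⟨j, x⟩] and [x] shows that [C m j] or [C j n],
    respectively, up to stage [z].  The entry [t] of the real with index ⟨n, m⟩
    is the rational coded by the first component of the least [w] that has not
    been refuted, up to stage [t], in both roles. *)
Let E m w z := exists j, j < w + 𝟏 /\ exists x, x < w + 𝟏 /\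
  (w = ⟨j, x⟩ /\ psi x z m j).
Let F n w z := exists i, i < w + 𝟏 /\ exists x, x < w + 𝟏 /\
  (w = ⟨i, x⟩ /\ psi x z i n).
Let H n m t w := (forall z, z < t + 𝟏 -> E m w z) \/ (forall z, z < t + 𝟏 -> F n w z).
Let stage n m t w := (H n m t w \/ t < w)
  /\ forall w', w' < w -> ~ (H n m t w' \/ t < w').

(** The bounds occur in the definitions only to make them Delta_0; they cost nothing because a pair
    dominates its components. *)
Lemma pair_bounds (P : M -> M -> Prop) w :
  (exists i, i < w + 𝟏 /\ exists x, x < w + 𝟏 /\ (w = ⟨i, x⟩ /\ P i x)) <->
  exists i x, w = ⟨i, x⟩ /\ P i x.
Proof.
split=> [[i [_ [x [_ Hx]]]]|[i [x [-> Hx]]]]; first by exists i, x.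
exists i; split; first by have := mpr_ge1 i x; mlra.
exists x; split; first by have := mpr_ge2 i x; mlra.
by [].
Qed.

Lemma E_all m w : (forall z, E m w z) <-> exists j x, w = ⟨j, x⟩ /\ forall z, psi x z m j.
Proof.
split=> [Hw|[j [x [Ew Hx]]] z]; last by apply/pair_bounds; exists j, x.
have /pair_bounds [j [x [Ew _]]] := Hw 𝟎; exists j, x; split=> // z.
have /pair_bounds [j' [x' [Ew' Hz]]] := Hw z.
by move: Ew'; rewrite Ew => /mpr_inj [-> ->].
Qed.

Lemma F_all n w : (forall z, F n w z) <-> exists i x, w = ⟨i, x⟩ /\ forall z, psi x z i n.
Proof.
split=> [Hw|[j [x [Ew Hx]]] z].
  have /pair_bounds [j [x [Ew _]]] := Hw 𝟎; exists j, x; split=> // z.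
  have /pair_bounds [j' [x' [Ew' Hz]]] := Hw z.
  by move: Ew'; rewrite Ew => /mpr_inj [-> ->].
by apply/(pair_bounds (fun i x => psi x z i n)); exists j, x.
Qed.

Lemma H_all n m w :
  (forall t, H n m t w) <-> (forall z, E m w z) \/ (forall z, F n w z).
Proof.
split=> [Hw|[Hw|Hw] t]; [|by left=> z _|by right=> z _].
(* Refutations of both roles, found at [z1] and [z2], are both visible at stage [z1 + z2]. *)
apply: NNPP => /not_or_and [/not_all_ex_not [z1 H1] /not_all_ex_not [z2 H2]].
by case: (Hw (z1 + z2)) => K; [apply: H1 | apply: H2]; apply: K; mlra.
Qed.

Lemma H_mono n m t t' w : t <= t' -> H n m t' w -> H n m t w.
Proof. by move=> le [K|K]; [left|right] => z Hz; apply: K; mlra. Qed.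

Lemma E_Def : Def (fun v => E (v 0) (v 1) (v 2)).
Proof. by rewrite /E /mpr; def. Qed.
Lemma H_Def : Def (fun v => H (v 0) (v 1) (v 2) (v 3)).
Proof. by rewrite /H /E /F /mpr; def. Qed.
Lemma stage_Def : Def (fun v => stage (v 0) (v 1) (v 2) (v 3)).
Proof. have HD := H_Def; by rewrite /stage; def. Qed.

(** The alternative [t < w] in [stage] caps the search at t + 1. Each approximation thus exists and
    is found by a bounded search, even while the true witnesses are still out of reach. *)
Lemma stage_exists n m t : exists w, w < t + 𝟏 + 𝟏 /\ stage n m t w.
Proof.
have HD := H_Def.
have [||w [b [Hw min]]] := @least_pi1 M (fun w _ => H n m t w \/ t < w).
- by def.
- by exists (t + 𝟏) => _; right; mlra.
have st : stage n m t w by split=> [|w' /min [z []]] //; apply: Hw.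
exists w; split=> //; apply: NNPP => nlt.
have /(proj2 st) K : t + 𝟏 < w by mlra.
by apply: K; right; mlra.
Qed.

Lemma stage_unique n m t w w' : stage n m t w -> stage n m t w' -> w = w'.
Proof.
move=> [H1 H2] [H3 H4]; case: (mlt_total w w') => [/H4 //|[//|/H2 //]].
Qed.

Lemma E_total m : exists w, forall z, E m w z.
Proof.
have [tot _] := C_inj; have [j [x Hx]] := tot m.
by exists ⟨j, x⟩; apply/E_all; exists j, x.
Qed.

(** The least candidate that is never refuted exists because [m] has a witness, whether or not [n]
    is a value of [C]. The bound from [least_pi1] refutes all smaller candidates at once, which
    would otherwise call for bounding. *)
Lemma stage_limit n m : exists w b,
  [/\ forall t, H n m t w,
      forall w', w' < w -> ~ (forall t, H n m t w') &
      forall t w', b <= t -> stage n m t w' -> w' = w].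
Proof.
have HD := H_Def.
have [||w [b [Hw min]]] := @least_pi1 M (fun w t => H n m t w).
- by def.
- by have [w Hw] := E_total m; exists w; apply/H_all; left.
(* From [b] on the smaller candidates are refuted; from [w] on the cap no longer admits them. *)
exists w, (b + w); split=> // [w' /min [z [_ K]] /(_ z)|t w' bt st] //.
apply: stage_unique st _; split=> [|w2 w2w]; first by left.
have [z [zb Hz]] := min w2 w2w.
move=> [/H_mono K|K]; last by mlra.
by apply: Hz; apply: K; mlra.
Qed.

(** A bound would code the restriction of [C] to [N + 2] arguments. *)
Lemma E_unbounded s : exists m, m < N + 𝟏 + 𝟏 /\ forall w, w < s -> ~ forall z, E m w z.
Proof.
apply: NNPP => no.
have {}no m : m < N + 𝟏 + 𝟏 -> exists w, w < s /\ forall z, E m w z.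
  move=> Hm; apply: NNPP => no1; apply: no; exists m; split=> // w ws Ew.
  by apply: no1; exists w.
have ED := E_Def; pose U := ⟨N + 𝟏 + 𝟏, s⟩ + 𝟏.
have [c [D [c0 cU D0 DU]]] := moduli_exist U.
(* Being a witness is Pi_1, whereas [code_set] codes Sigma_1-sets; so the non-witnesses are coded,
   and witnesses are recognized by non-divisibility. *)
have [|d [_ [_ Hd]]] := code_set c0 cU D0 DU (A := fun u z =>
  exists m, m < u + 𝟏 /\ exists w, w < u + 𝟏 /\ (u = ⟨m, w⟩ /\ ~ E m w z)).
  by rewrite /mpr; def.
have {}Hd m w : m < N + 𝟏 + 𝟏 -> w < s ->
    (~ mdvd (modulus c ⟨m, w⟩) d <-> forall z, E m w z).
  move=> Hm Hw; rewrite Hd; last first.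
    have : ⟨m, w⟩ <= ⟨N + 𝟏 + 𝟏, s⟩ by apply: mpr_mono; left.
    by rewrite /U; mlra.
  split=> [K z|K [z /(pair_bounds (fun m w => ~ E m w z)) [m' [w' [/mpr_inj [<- <-]]]]]].
    apply: NNPP => nE; apply: K; exists z.
    by apply/(pair_bounds (fun m w => ~ E m w z)); exists m, w.
  by apply.
pose R m j := exists w, w < s /\ (~ mdvd (modulus c ⟨m, w⟩) d
  /\ exists x, x < w + 𝟏 /\ w = ⟨j, x⟩).
have RC m j : m < N + 𝟏 + 𝟏 -> R m j -> C m j.
  move=> Hm [w [ws [/(Hd _ _ Hm ws) /E_all [j' [x' [-> Hx]]] [x [_ /mpr_inj [<- _]]]]]].
  by exists x'.
have [_ [Cle [_ Cinj]]] := C_inj.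
apply: (@pigeonhole M R (N + 𝟏)).
- by rewrite /R /mdvd /modulus /mpr; def.
- move=> m Hm; have [w [ws Ew]] := no m Hm.
  have /E_all [j [x [Ejx Hx]]] := Ew.
  exists j; split; first by have := Cle m j (ex_intro _ x Hx); mlra.
  exists w; split=> //; split; first by apply/Hd.
  by exists x; split=> //; have := mpr_ge2 j x; rewrite -Ejx; mlra.
- move=> m m' j Hm Hm' _ /RC K /RC K'; apply: (Cinj m m' j).
  by split; [apply: K | apply: K'].
Qed.

(** * From approximations to a family of rational sequences *)

Let is_code r := exists p, p < r + 𝟏 /\ exists n, n < r + 𝟏 /\
  exists d, d < r + 𝟏 /\ r = ⟨p, n, d⟩.
(** The default 0 equals ⟨0, 0, 0⟩ and hence codes the rational 0, so a rational results even when
    the first component of [w] is not a code. *)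
Let out w r := (exists x, x < w + 𝟏 /\ (w = ⟨r, x⟩ /\ is_code r))
  \/ (r = 𝟎 /\ ~ exists r', r' < w + 𝟏 /\ exists x, x < w + 𝟏 /\
        (w = ⟨r', x⟩ /\ is_code r')).
(** Every index up to the last one must carry a real, including numbers that are not pairs; these
    get the constant sequence 0. *)
Let value k t r := (exists n, n < k + 𝟏 /\ exists m, m < k + 𝟏 /\ (k = ⟨n, m⟩
      /\ exists w, w < t + 𝟏 + 𝟏 /\ (stage n m t w /\ out w r)))
  \/ (r = 𝟎 /\ ~ exists n, n < k + 𝟏 /\ exists m, m < k + 𝟏 /\ k = ⟨n, m⟩).

Lemma is_codeP r : is_code r <-> exists a : mrat M, r = mcode a.
Proof.
split=> [[p [_ [n [_ [d [_ ->]]]]]]|[[p n d] ->]]; first by exists (MRat p n d).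
rewrite /mcode /=; have := mpr_ge1 p ⟨n, d⟩; have := mpr_ge2 p ⟨n, d⟩.
have := mpr_ge1 n d; have := mpr_ge2 n d => H1 H2 H3 H4.
exists p; split; first by mlra.
exists n; split; first by mlra.
exists d; split; first by mlra.
by [].
Qed.

Lemma zero_code : is_code 𝟎.
Proof. by apply/is_codeP; exists (mrzero M); rewrite /mcode /= !mpr00. Qed.

Lemma out_code w r : out w r -> is_code r.
Proof. by move=> [[x [_ [_ //]]]|[-> _]]; apply: zero_code. Qed.

Lemma out_exists w : exists r, out w r.
Proof.
case: (pselect (exists r', r' < w + 𝟏 /\ exists x, x < w + 𝟏 /\
  (w = ⟨r', x⟩ /\ is_code r'))) => K; last by exists 𝟎; right.
by have [r' [_ [x Hx]]] := K; exists r'; left; exists x.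
Qed.

Lemma out_unique w r r' : out w r -> out w r' -> r = r'.
Proof.
have aux x q : w = ⟨q, x⟩ -> is_code q -> exists r', r' < w + 𝟏 /\
    exists x, x < w + 𝟏 /\ (w = ⟨r', x⟩ /\ is_code r').
  by move=> Ew Hq; apply/(pair_bounds (fun r _ => is_code r)); exists q, x.
move=> [[x [_ [Ex Hr]]]|[-> K]] [[x' [_ [Ex' Hr']]]|[-> K']] //.
- by move: Ex'; rewrite Ex => /mpr_inj [].
- by case: K'; apply: aux Ex Hr.
- by case: K; apply: aux Ex' Hr'.
Qed.

Lemma out_pair r x : is_code r -> out ⟨r, x⟩ r.
Proof.
move=> Hr; left; exists x; split=> //; have := mpr_ge2 r x.
by mlra.
Qed.

Lemma value_code k t r : value k t r -> is_code r.
Proof.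
move=> [[n [_ [m [_ [_ [w [_ [_ /out_code //]]]]]]]]|[-> _]]; exact: zero_code.
Qed.

Lemma value_pair n m t r : value ⟨n, m⟩ t r <-> exists w, stage n m t w /\ out w r.
Proof.
split=> [[[n' [_ [m' [_ [/mpr_inj [<- <-] [w [_ [Hs Ho]]]]]]]]|[_ []]]|[w [Hs Ho]]].
- by exists w.
- exists n; split; first by have := mpr_ge1 n m; mlra.
  by exists m; split=> //; have := mpr_ge2 n m; mlra.
- left; exists n; split; first by have := mpr_ge1 n m; mlra.
  exists m; split; first by have := mpr_ge2 n m; mlra.
  split=> //; exists w; split=> //.
  by have [w' [lw' Hw']] := stage_exists n m t; rewrite (stage_unique Hs Hw').
Qed.

Lemma value_npair k t r : (~ exists n m, k = ⟨n, m⟩) -> (value k t r <-> r = 𝟎).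
Proof.
move=> K; split=> [[[n [_ [m [_ [Ek _]]]]]|[-> _]] //|->].
  by case: K; exists n, m.
by right; split=> // -[n [_ [m [_ Ek]]]]; apply: K; exists n, m.
Qed.

Lemma value_limit n m : exists w b, [/\ forall t, H n m t w,
  forall w', w' < w -> ~ (forall t, H n m t w') &
  forall t r, b <= t -> value ⟨n, m⟩ t r -> out w r].
Proof.
have [w [b [H1 H2 H3]]] := stage_limit n m; exists w, b; split=> // t r bt.
by move=> /value_pair [w' [Hs]]; rewrite (H3 _ _ bt Hs).
Qed.

Lemma value_exists k t : exists r, value k t r.
Proof.
case: (pselect (exists n m, k = ⟨n, m⟩)) => [[n [m ->]]|K].
  have [w [_ Hs]] := stage_exists n m t; have [r Hr] := out_exists w.
  by exists r; apply/value_pair; exists w.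
by exists 𝟎; apply/(value_npair _ _ K).
Qed.

Lemma value_unique k t r r' : value k t r -> value k t r' -> r = r'.
Proof.
case: (pselect (exists n m, k = ⟨n, m⟩)) => [[n [m ->]]|K].
  move=> /value_pair [w [Hs Ho]] /value_pair [w' [Hs' Ho']].
  by apply: out_unique Ho _; rewrite (stage_unique Hs Hs').
by move=> /(value_npair _ _ K) -> /(value_npair _ _ K) ->.
Qed.

Lemma value_eventually k : exists b r, forall t r', b <= t -> value k t r' -> r' = r.
Proof.
case: (pselect (exists n m, k = ⟨n, m⟩)) => [[n [m ->]]|K].
  have [w [b [_ _ Hb]]] := value_limit n m; have [r Hr] := out_exists w.
  exists b, r => t r' bt Hv; exact: out_unique (Hb _ _ bt Hv) Hr.
by exists 𝟎, 𝟎 => t r' _ /(value_npair _ _ K).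
Qed.

Lemma value_Def : Def (fun v => value (v 0) (v 1) (v 2)).
Proof.
have HD := stage_Def; rewrite /value /out /is_code /mpr; by def.
Qed.

(** Pairing is monotone, so this bounds all pairs ⟨n, m⟩ with n <= N and m <= N + 2, in particular
    those with m among the N + 2 arguments of [E_unbounded]. *)
Let K := ⟨N, N + 𝟏 + 𝟏⟩.

Lemma dense_collection : exists X, mfinite_collection K X /\
  forall Y Z, mreal Y -> mreal Z -> mreal_lt (mseq_of_set Y) (mseq_of_set Z) ->
  exists k, k <= K /\ mreal_le (mseq_of_set Y) (mseq_of_family X k)
    /\ mreal_le (mseq_of_family X k) (mseq_of_set Z).
Proof.
have VD := value_Def.
have [|X HX] := @delta0_comprehension _ HM (fun z => exists k, k < K + 𝟏 /\
  exists t, t < z + 𝟏 /\ exists r, r < z + 𝟏 /\ (z = ⟨⟨k, t⟩, r⟩ /\ value k t r)).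
  by rewrite /mpr; def.
have XE k t (a : mrat M) : k <= K ->
    (mseq_of_family X k t a <-> value k t (mcode a)).
  move=> kK; rewrite /mseq_of_family HX.
  split=> [[k' [_ [t' [_ [r [_ [/mpr_inj [/mpr_inj [<- <-] <-]]]]]]]] //|Hv].
  exists k; split; first by mlra.
  have H1 := mpr_ge2 k t; have H2 := mpr_ge1 ⟨k, t⟩ (mcode a).
  have H3 := mpr_ge2 ⟨k, t⟩ (mcode a).
  exists t; split; first by mlra.
  exists (mcode a); split; last by [].
  by mlra.
have Xseq k : k <= K -> mis_seq (mseq_of_family X k).
  move=> kK; apply/mis_seqP => t; split=> [|a b].
    have [r Hr] := value_exists k t; have /is_codeP [a Ea] := value_code Hr.
    by exists a; apply/XE => //; rewrite -Ea.
  by move=> /(XE _ _ _ kK) Ha /(XE _ _ _ kK) Hb; apply/mcode_inj/(value_unique Ha Hb).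
exists X; split; first split.
- move=> z /HX [k [kK [t [_ [r [_ [-> Hv]]]]]]]; exists k, t; split; first by mlra.
  by apply/mrexP; have /is_codeP [a ->] := value_code Hv; exists a.
- move=> k kK; split; first exact: Xseq.
  apply: eventually_constant_mcauchy.
  have [b [r Hr]] := value_eventually k.
  have [r0 Hr0] := value_exists k b; have /is_codeP [c Ec] := value_code Hr0.
  have rc : r0 = r by apply: Hr Hr0; right.
  exists b, c => t bt a /(XE _ _ _ kK) Ha; apply: mcode_inj.
  by rewrite -Ec rc; apply: Hr Ha.
move=> Y Z [_ [_ CY]] [_ [_ CZ]] /(mreal_lt_between CY CZ) [c [T HT]].
pose i := mcode c; have ic : is_code i by apply/is_codeP; exists c.
have [tot [Cle [_ Cinj]]] := C_inj.
have [n [x Hx]] := tot i; have nN := Cle i n (ex_intro _ x Hx).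
(* The pair ⟨i, x⟩ is a true candidate for [n]. With [m] having no witness up to this pair, the
   limit [w] is at most the pair and must be a candidate for [n]. *)
have [m [mN Hm]] := E_unbounded (⟨i, x⟩ + 𝟏).
have [w [b [Hw min Hb]]] := value_limit n m.
have wle : w <= ⟨i, x⟩.
  apply: NNPP => K1; have /min : ⟨i, x⟩ < w by mlra.
  by apply; apply/H_all; right; apply/F_all; exists i, x.
(* Minimality only yields some ⟨i', x'⟩ where x' shows C(i') = n; injectivity of [C] turns i' into
   i. *)
have [x' Ew] : exists x', w = ⟨i, x'⟩.
  have [Ew|/F_all [i' [x' [Ew Hx']]]] := proj1 (H_all n m w) Hw.
    by case: (Hm w) => //; mlra.
  exists x'; rewrite Ew; congr (⟨_, _⟩); apply: (Cinj i' i n).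
  by split; [exists x' | exists x].
have kK : ⟨n, m⟩ <= K by apply: mpr_mono => //; left.
have ev t a : b <= t -> mseq_of_family X ⟨n, m⟩ t a -> a = c.
  move=> bt /(XE _ _ _ kK) /(Hb _ _ bt); rewrite Ew => Ho.
  by apply: mcode_inj; apply: out_unique Ho _; apply: out_pair.
exists ⟨n, m⟩; split=> //; split; apply: eventually_mreal_le; exists (b + T);
  move=> t Ht a a'; (have bt : b <= t by mlra); (have Tt : T <= t by mlra).
- by move=> Ha /(ev _ _ bt) ->; apply: (HT t Tt).1.
- by move=> /(ev _ _ bt) -> Ha; apply: (HT t Tt).2.
Qed.

End Dense.

Theorem no_dense_cardinality (M : rca_model) : no_dense M -> cardinality M.
Proof.
move=> ND [N [p [v [X [_ Cinj]]]]].
(* Cutting off y and the unbounded quantifiers of [mtrue_delta0] at a common z makes the matrix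
   Delta_0, as the search by stages requires. *)
pose psi x z i j := forall y, y < z + 𝟏 -> forall B, B < z + 𝟏 ->
  forall m, m < z + 𝟏 -> forall n, n < z + 𝟏 ->
  mevaluation (MFinSet B m n) X -> forall b, b < B ->
  mfin_mem (mform_entry p ⟨y, x, i, j, v⟩ b) (MFinSet B m n) -> b = 𝟏.
have CE i j : (exists x, forall z, psi x z i j) <-> mtrue_sigma2 p ⟨i, j, v⟩ X.
  split=> [[x Hx]|[x Hx]]; exists x.
    move=> y B m n; apply: (Hx (y + B + m + n)); to_frac; lra.
  by move=> z y _ B _ m _ n _; apply: Hx.
have Cinj' : minjection_into N (fun i j => exists x, forall z, psi x z i j).
  move: Cinj => [H1 [H2 [H3 H4]]]; split; [|split; [|split]].
  - by move=> i; have [j /CE] := H1 i; exists j.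
  - by move=> i j /CE; apply: H2.
  - by move=> i j k [/CE ? /CE ?]; apply: (H3 i j k).
  - by move=> i j k [/CE ? /CE ?]; apply: (H4 i j k).
have [|K [HK dense]] := dense_collection _ Cinj'.
  rewrite /psi /mevaluation /mfin_mem /mform_entry /mterm_entry /muncons
    /mtruth_value /mpr; cbv zeta; cbn [mbound mfmod mfnum]; by def.
have [Y [Z [RY [RZ [ltYZ no]]]]] := ND _ _ HK.
have [k [kK le]] := dense Y Z RY RZ ltYZ.
exact: (no k kK).
Qed.

(** * Truth of atomic formulas *)

Section Truth.
Variable M : rca_model.
Implicit Types (w : mfinset M) (x y z : M).

Lemma mnum_inj i j : mnum M i = mnum M j -> i = j.
Proof.
elim: i j => [|i IH] [|j] //= E.
- by exfalso; apply: (@madd1_neq0 M (mnum M j)).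
- by exfalso; apply: (@madd1_neq0 M (mnum M i)).
- by rewrite (IH j) //; apply: madd1_inj.
Qed.

Lemma In_Def (l : list M) : Def (fun v => In (v 0) l).
Proof. by have X0 := rca_set M; elim: l => [|a l IH] /=; def. Qed.

(** Evaluating a standard formula produces only standardly many entries, so external lists suffice.
    Membership in such a list is a finite disjunction of equations with parameters, hence
    Delta_0. *)
Lemma code_list (l : list M) : exists w, forall z, mfin_mem z w <-> In z l.
Proof.
have [U HU] : exists U, forall z, In z l -> z < U.
  elim: l => [|a l [U HU]]; first by exists 𝟎.
  exists (U + a + 𝟏) => z /= [<-|/HU K]; mlra.
have [m [D [m0 mU D0 DU]]] := moduli_exist U.
have [|d [_ [_ Hd]]] := code_set m0 mU D0 DU (A := fun u _ => In u l).
  exact: In_Def.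
exists (MFinSet U m d) => z; split=> [[zU /(Hd _ zU) [_ //]]|Hz].
have zU := HU z Hz; split=> //; apply/(Hd _ zU); by exists z.
Qed.

Fixpoint tcode (t : term) : M :=
  match t with
  | TVar k => ⟨mnum M 0, mnum M k⟩
  | TZero => ⟨mnum M 1, mnum M 0⟩
  | TOne => ⟨mnum M 2, mnum M 0⟩
  | TAdd t u => ⟨mnum M 3, tcode t, tcode u⟩
  | TMul t u => ⟨mnum M 4, tcode t, tcode u⟩
  end.

(** The atom saying that the value of [t] lies in set parameter 0, that is, in the set of all x with
    ⟨0, x⟩ in X. *)
Definition atom_code (t : term) : M := ⟨mnum M 3, mnum M 0, tcode t⟩.

Lemma mterm_entry_inj (t s y t' s' y' : M) :
  mterm_entry t s y = mterm_entry t' s' y' -> [/\ t = t', s = s' & y = y'].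
Proof. by move=> /mpr_inj [_ /mpr_inj [-> /mpr_inj [-> ->]]]. Qed.
Lemma mform_entry_inj (t s y t' s' y' : M) :
  mform_entry t s y = mform_entry t' s' y' -> [/\ t = t', s = s' & y = y'].
Proof. by move=> /mpr_inj [_ /mpr_inj [-> /mpr_inj [-> ->]]]. Qed.
Lemma mterm_form_entry (t s y t' s' y' : M) : mterm_entry t s y <> mform_entry t' s' y'.
Proof. by move=> /mpr_inj [/(@mnum_inj 0 1)]. Qed.

Lemma triple_bound (c a b d B : M) : ⟨c, a, b, d⟩ < B -> [/\ a < B, b < B & d < B].
Proof.
have H1 := mpr_ge2 c ⟨a, b, d⟩; have H2 := mpr_ge1 a ⟨b, d⟩.
have H3 := mpr_ge2 a ⟨b, d⟩; have H4 := mpr_ge1 b d; have H5 := mpr_ge2 b d.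
by move=> H; split; mlra.
Qed.

Lemma pair_lt (a b B : M) : ⟨a, b⟩ < B -> a < B /\ b < B.
Proof.
have H1 := mpr_ge1 a b; have H2 := mpr_ge2 a b.
by move=> H; split; mlra.
Qed.

(** [s k] is the code of the assignment of [v k], [v (k + 1)], ... *)
Definition codes_assignment (v s : nat -> M) := forall k, s k = ⟨v k, s (S k)⟩.

Lemma codes_assignment_shift v s : codes_assignment v s ->
  codes_assignment (fun k => v (S k)) (fun k => s (S k)).
Proof. by move=> H k; apply: H. Qed.

Lemma muncons_pair (a b x r : M) : muncons ⟨a, b⟩ x r -> x = a /\ r = b.
Proof.
move=> [/mpr_inj [-> ->] //|[_ [_ []]]]; exists a.
split; first by have := mpr_ge1 a b; mlra.
by exists b; split=> //; have := mpr_ge2 a b; mlra.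
Qed.

(** An evaluation merely has to support each of its entries by others. The induction on [t] follows
    this support backwards; the tag of the code excludes all clauses but one. Variables are looked
    up by peeling the assignment, so their case is an induction on the index with a shifted
    assignment. *)
Lemma evaluation_unique w X t : mevaluation w X ->
  forall v s, codes_assignment v s ->
  forall y, mfin_mem (mterm_entry (tcode t) (s 0) y) w -> y = eval v t.
Proof.
move=> [ev _]; elim: t => [k|||t IHt u IHu|t IHt u IHu] v s cs y Hm;
  have [ltB _] := Hm; have [tB sB yB] := triple_bound ltB;
  have := ev _ tB _ sB _ yB Hm.
- elim: k v s cs y {Hm ltB tB sB yB} (Hm) => [|k IH] v s cs y Hm;
    have [ltB _] := Hm; have [tB sB yB] := triple_bound ltB.
  + move=> [[x [_ [r [_ [Hu Hc]]]]]|[[E _]|[[E _]|Hc]]].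
    * rewrite (cs 0) in Hu; have [Ex _] := muncons_pair Hu.
      move: Hc => [[_ ->] //|[k [_ [/mpr_inj [_ E] _]]]].
      by exfalso; apply: (@madd1_neq0 M k).
    * by case/mpr_inj: E => /(@mnum_inj 0 1).
    * by case/mpr_inj: E => /(@mnum_inj 0 2).
    * move: Hc => [u [_ [v' [_ [a [_ [b [_ [_ [_ [[E _]|[E _]]]]]]]]]]]].
        by case/mpr_inj: E => /(@mnum_inj 0 3).
      by case/mpr_inj: E => /(@mnum_inj 0 4).
  + move=> [[x [_ [r [_ [Hu Hc]]]]]|[[E _]|[[E _]|Hc]]].
    * rewrite (cs 0) in Hu; have [_ Er] := muncons_pair Hu; rewrite Er in Hc.
      move: Hc => [[/mpr_inj [_ E] _]|[k' [_ [/mpr_inj [_ E] Hm']]]].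
        by exfalso; apply: (@madd1_neq0 M (mnum M k)).
      rewrite -(madd1_inj E) in Hm'.
      apply: (IH _ _ (codes_assignment_shift cs) _ Hm').
      have [ltB' _] := Hm'; have [tB' sB' yB'] := triple_bound ltB'.
      exact: ev _ tB' _ sB' _ yB' Hm'.
    * by case/mpr_inj: E => /(@mnum_inj 0 1).
    * by case/mpr_inj: E => /(@mnum_inj 0 2).
    * move: Hc => [u [_ [v' [_ [a [_ [b [_ [_ [_ [[E _]|[E _]]]]]]]]]]]].
        by case/mpr_inj: E => /(@mnum_inj 0 3).
      by case/mpr_inj: E => /(@mnum_inj 0 4).
- move=> [[x [_ [r [_ [Hu Hc]]]]]|[[E ->] //|[[E _]|Hc]]].
  + by move: Hc => [[E _]|[k' [_ [E _]]]]; case/mpr_inj: E => /(@mnum_inj 1 0).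
  + by case/mpr_inj: E => /(@mnum_inj 1 2).
  + move: Hc => [u [_ [v' [_ [a [_ [b [_ [_ [_ [[E _]|[E _]]]]]]]]]]]].
      by case/mpr_inj: E => /(@mnum_inj 1 3).
    by case/mpr_inj: E => /(@mnum_inj 1 4).
- move=> [[x [_ [r [_ [Hu Hc]]]]]|[[E _]|[[E ->] //|Hc]]].
  + by move: Hc => [[E _]|[k' [_ [E _]]]]; case/mpr_inj: E => /(@mnum_inj 2 0).
  + by case/mpr_inj: E => /(@mnum_inj 2 1).
  + move: Hc => [u [_ [v' [_ [a [_ [b [_ [_ [_ [[E _]|[E _]]]]]]]]]]]].
      by case/mpr_inj: E => /(@mnum_inj 2 3).
    by case/mpr_inj: E => /(@mnum_inj 2 4).
- move=> [[x [_ [r [_ [Hu Hc]]]]]|[[E _]|[[E _]|Hc]]].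
  + by move: Hc => [[E _]|[k' [_ [E _]]]]; case/mpr_inj: E => /(@mnum_inj 3 0).
  + by case/mpr_inj: E => /(@mnum_inj 3 1).
  + by case/mpr_inj: E => /(@mnum_inj 3 2).
  + move: Hc => [u' [_ [v' [_ [a [_ [b [_ [Ha [Hb [[E ->]|[E _]]]]]]]]]]]].
      case/mpr_inj: E => _ /mpr_inj [Eu Ev]; rewrite -Eu in Ha; rewrite -Ev in Hb.
      by rewrite (IHt _ _ cs _ Ha) (IHu _ _ cs _ Hb).
    by case/mpr_inj: E => /(@mnum_inj 3 4).
- move=> [[x [_ [r [_ [Hu Hc]]]]]|[[E _]|[[E _]|Hc]]].
  + by move: Hc => [[E _]|[k' [_ [E _]]]]; case/mpr_inj: E => /(@mnum_inj 4 0).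
  + by case/mpr_inj: E => /(@mnum_inj 4 1).
  + by case/mpr_inj: E => /(@mnum_inj 4 2).
  + move: Hc => [u' [_ [v' [_ [a [_ [b [_ [Ha [Hb [[E _]|[E ->]]]]]]]]]]]].
      by case/mpr_inj: E => /(@mnum_inj 4 3).
    case/mpr_inj: E => _ /mpr_inj [Eu Ev]; rewrite -Eu in Ha; rewrite -Ev in Hb.
    by rewrite (IHt _ _ cs _ Ha) (IHu _ _ cs _ Hb).
Qed.


(** The term clause of [mevaluation] for a list, without bounds on the quantifiers: once the list is
    coded, components of its entries are automatically below the bound of the code. *)
Definition justified (l : list M) (t s y : M) :=
  (exists x r, s = ⟨x, r⟩ /\ ((t = ⟨mnum M 0, mnum M 0⟩ /\ y = x)
     \/ exists k, t = ⟨mnum M 0, k + 𝟏⟩ /\ In (mterm_entry ⟨mnum M 0, k⟩ r y) l))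
  \/ (t = ⟨mnum M 1, mnum M 0⟩ /\ y = 𝟎)
  \/ (t = ⟨mnum M 2, mnum M 0⟩ /\ y = 𝟏)
  \/ exists u v a b, In (mterm_entry u s a) l /\ In (mterm_entry v s b) l
     /\ ((t = ⟨mnum M 3, u, v⟩ /\ y = a + b) \/ (t = ⟨mnum M 4, u, v⟩ /\ y = a * b)).

Definition justified_list (l : list M) := forall z, In z l ->
  exists t s y, z = mterm_entry t s y /\ justified l t s y.

Lemma justified_incl l l' t s y : incl l l' -> justified l t s y -> justified l' t s y.
Proof.
move=> sub [[x [r [Es [H|[k [Et H]]]]]]|[H|[H|[u [v [a [b [Ha [Hb H]]]]]]]]].
- by left; exists x, r; split=> //; left.
- by left; exists x, r; split=> //; right; exists k; split=> //; apply: sub.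
- by right; left.
- by right; right; left.
- right; right; right; exists u, v, a, b.
  by split; [apply: sub | split; [apply: sub|]].
Qed.

Lemma justified_cons l t s y : justified_list l -> justified l t s y ->
  justified_list (mterm_entry t s y :: l).
Proof.
have sub e : incl l (e :: l) by apply: incl_tl; apply: incl_refl.
move=> Hl H z /= [<-|/Hl [t' [s' [y' [-> H']]]]].
  by exists t, s, y; split=> //; apply: justified_incl H.
by exists t', s', y'; split=> //; apply: justified_incl H'.
Qed.

Lemma justified_app l l' :
  justified_list l -> justified_list l' -> justified_list (l ++ l').
Proof.
move=> Hl Hl' z Hz; case: (in_app_or _ _ _ Hz) => [/Hl|/Hl'] [t [s [y [-> H]]]]; exists t, s, y; split=> //.
  by apply: justified_incl H; apply: incl_appl; apply: incl_refl.
by apply: justified_incl H; apply: incl_appr; apply: incl_refl.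
Qed.

Lemma justified_exists t v s : codes_assignment v s -> exists l,
  justified_list l /\ In (mterm_entry (tcode t) (s 0) (eval v t)) l.
Proof.
elim: t v s => [k|||t IHt u IHu|t IHt u IHu] v s cs.
- elim: k v s cs => [|k IH] v s cs.
  + eexists (_ :: _); split; last by left.
    apply: (justified_cons (l := nil)) => //; left; exists (v 0), (s 1); split; first exact: cs.
    by left.
  + have [l [Hl Hin]] := IH _ _ (codes_assignment_shift cs).
    eexists (_ :: _); split; last by left.
    apply: (justified_cons Hl); left; exists (v 0), (s 1); split; first exact: cs.
    by right; exists (mnum M k).
- eexists (_ :: _); split; last by left.
  by apply: (justified_cons (l := nil)) => //; right; left.
- eexists (_ :: _); split; last by left.
  by apply: (justified_cons (l := nil)) => //; right; right; left.
- have [l1 [H1 I1]] := IHt _ _ cs; have [l2 [H2 I2]] := IHu _ _ cs.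
  eexists (_ :: _); split; last by left.
  apply: (justified_cons (justified_app H1 H2)); right; right; right.
  exists (tcode t), (tcode u), (eval v t), (eval v u).
  by split; [apply: in_or_app; left | split; [apply: in_or_app; right | left]].
- have [l1 [H1 I1]] := IHt _ _ cs; have [l2 [H2 I2]] := IHu _ _ cs.
  eexists (_ :: _); split; last by left.
  apply: (justified_cons (justified_app H1 H2)); right; right; right.
  exists (tcode t), (tcode u), (eval v t), (eval v u).
  by split; [apply: in_or_app; left | split; [apply: in_or_app; right | right]].
Qed.

Lemma evaluation_exists X t v s : codes_assignment v s -> exists w b,
  [/\ mevaluation w X, mtruth_value b (⟨𝟎, eval v t⟩ ∈ X) &
      mfin_mem (mform_entry (atom_code t) (s 0) b) w].
Proof.
move=> cs; have [l [Hl Hin]] := justified_exists t cs.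
have [b Hb] : exists b : M, mtruth_value b (⟨𝟎, eval v t⟩ ∈ X).
  case: (pselect (⟨𝟎, eval v t⟩ ∈ X)) => H; first by exists 𝟏; left.
  by exists 𝟎; right.
have [w Hw] := code_list (mform_entry (atom_code t) (s 0) b :: l).
have wl z : In z l -> mfin_mem z w by move=> Hz; apply/Hw; right.
exists w, b; split=> //; last by apply/Hw; left.
split=> [t' t'B s' s'B y yB /Hw /= [E|/Hl]|p pB s' s'B b' b'B /Hw /= [E|/Hl]].
- by case: (@mterm_form_entry t' s' y (atom_code t) (s 0) b).
- move=> [t1 [s1 [y1 [/mterm_entry_inj [<- <- <-]]]]].
  move=> [[x [r [Es H]]]|[H|[H|[u [v' [a [c [Ha [Hc H]]]]]]]]].
  + left; exists x; split; first by have := mpr_ge1 x r; rewrite -Es; mlra.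
    exists r; split; first by have := mpr_ge2 x r; rewrite -Es; mlra.
    split; first by left.
    case: H => [H|[k [Et H]]]; [by left | right; exists k; split; last first].
      by split=> //; apply: wl.
    by rewrite Et in t'B; have [_] := pair_lt t'B; mlra.
  + by right; left.
  + by right; right; left.
  + right; right; right; move: Ha Hc => /wl Ha /wl Hc.
    have [/triple_bound [uB _ aB] _] := Ha; have [/triple_bound [vB _ cB] _] := Hc.
    exists u; split=> //; exists v'; split=> //.
    by exists a; split=> //; exists c; split.
- move: E => /mform_entry_inj [<- <- <-]; right; right; left.
  have /wl Hm := Hin; have [/triple_bound [tB _ eB] _] := Hm.
  exists 𝟎; split; first by mlra.
  by exists (tcode t); split=> //; exists (eval v t); split.
- by move=> [t1 [s1 [y1 [E _]]]]; case: (@mterm_form_entry t1 s1 y1 p s' b').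
Qed.

(** Truth is a statement about all evaluations. From left to right, it is applied to an evaluation
    that is known to exist; from right to left, an arbitrary evaluation must give the correct value
    to the term and therefore to the atom. *)
Lemma true_atom X t v s : codes_assignment v s ->
  (mtrue_delta0 (atom_code t) (s 0) X <-> ⟨𝟎, eval v t⟩ ∈ X).
Proof.
move=> cs; split=> [H|HX B m n w ev b bB Hm].
  have [[B m n] [b [ev Hb Hm]]] := evaluation_exists X t cs.
  have [/triple_bound [_ _ bB] _] := Hm.
  have := H B m n ev b bB Hm; case: Hb => [[_ //]|[-> _] E].
  by exfalso; apply: (@madd1_neq0 M 𝟎); rewrite madd0x.
have [/triple_bound [pB sB _] _] := Hm.
have := proj2 ev _ pB _ sB _ bB Hm.
move=> [[E _]|[[u [_ [v' [_ [x [_ [y [_ [_ [_ [[E _]|[E _]]]]]]]]]]]]|[|[]]]].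
- by case/mpr_inj: E => /(@mnum_inj 3 0).
- by case/mpr_inj: E => /(@mnum_inj 3 1).
- by case/mpr_inj: E => /(@mnum_inj 3 2).
- move=> [j [_ [u [_ [x [_ [Hx [/mpr_inj [_ /mpr_inj [<- Eu]] Hb]]]]]]]].
  rewrite -Eu in Hx; rewrite (evaluation_unique ev cs Hx) in Hb.
  by case: Hb => [[]|[_ []]].
- move=> [q [_ [r [_ [c [_ [d [_ [_ [_ [E _]]]]]]]]]]].
  by case/mpr_inj: E => /(@mnum_inj 3 4).
- move=> [u [_ [q [_ [y [_ [_ [E _]]]]]]]].
  by case/mpr_inj: E => /(@mnum_inj 3 5).
Qed.

(** * Formation of the code of an atomic formula *)

Definition formed (l : list M) (t : M) :=
  t = ⟨mnum M 1, mnum M 0⟩ \/ t = ⟨mnum M 2, mnum M 0⟩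
  \/ (exists k, t = ⟨mnum M 0, k⟩)
  \/ exists u v, In ⟨mnum M 0, u⟩ l /\ In ⟨mnum M 0, v⟩ l
      /\ (t = ⟨mnum M 3, u, v⟩ \/ t = ⟨mnum M 4, u, v⟩).

Definition formed_list (l : list M) := forall z, In z l ->
  exists t, z = ⟨mnum M 0, t⟩ /\ formed l t.

Lemma formed_incl l l' t : incl l l' -> formed l t -> formed l' t.
Proof.
move=> sub [H|[H|[H|[u [v [Hu [Hv H]]]]]]]; [by left|by right; left|..].
  by right; right; left.
right; right; right; exists u, v.
by split; [apply: sub | split; [apply: sub|]].
Qed.

Lemma formed_cons l t : formed_list l -> formed l t ->
  formed_list (⟨mnum M 0, t⟩ :: l).
Proof.
have sub e : incl l (e :: l) by apply: incl_tl; apply: incl_refl.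
move=> Hl H z /= [<-|/Hl [t' [-> H']]].
  by exists t; split=> //; apply: formed_incl H.
by exists t'; split=> //; apply: formed_incl H'.
Qed.

Lemma formed_app l l' : formed_list l -> formed_list l' -> formed_list (l ++ l').
Proof.
move=> Hl Hl' z Hz; case: (in_app_or _ _ _ Hz) => [/Hl|/Hl'] [t [-> H]]; exists t; split=> //.
  by apply: formed_incl H; apply: incl_appl; apply: incl_refl.
by apply: formed_incl H; apply: incl_appr; apply: incl_refl.
Qed.

Lemma formed_exists t : exists l, formed_list l /\ In ⟨mnum M 0, tcode t⟩ l.
Proof.
elim: t => [k|||t [l1 [H1 I1]] u [l2 [H2 I2]]|t [l1 [H1 I1]] u [l2 [H2 I2]]];
  eexists (_ :: _); (split; last by left).
- by apply: (formed_cons (l := nil)) => //; right; right; left; exists (mnum M k).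
- by apply: (formed_cons (l := nil)) => //; left.
- by apply: (formed_cons (l := nil)) => //; right; left.
- apply: (formed_cons (formed_app H1 H2)); right; right; right.
  exists (tcode t), (tcode u).
  by split; [apply: in_or_app; left | split; [apply: in_or_app; right | left]].
- apply: (formed_cons (formed_app H1 H2)); right; right; right.
  exists (tcode t), (tcode u).
  by split; [apply: in_or_app; left | split; [apply: in_or_app; right | right]].
Qed.

Lemma atom_is_delta0_code t : mis_delta0_code (atom_code t).
Proof.
have [l [Hl Hin]] := formed_exists t.
have [[B m n] Hw] := code_list (⟨mnum M 1, atom_code t⟩ :: l).
exists B, m, n; split; last by apply/Hw; left.
have wl z : In z l -> mfin_mem z (MFinSet B m n) by move=> Hz; apply/Hw; right.
split=> [t' t'B /Hw /= [/mpr_inj [/(@mnum_inj 1 0)]//|/Hl]|p pB /Hw /= [/mpr_inj [_ <-]|/Hl]].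
- move=> [t1 [/mpr_inj [_ <-] [H|[H|[[k Ek]|[u [v [/wl Hu [/wl Hv H]]]]]]]]].
  + by left.
  + by right; left.
  + right; right; left; exists k; split=> //.
    by rewrite Ek in t'B; have [] := pair_lt t'B.
  + right; right; right.
    have [/pair_lt [_ uB] _] := Hu; have [/pair_lt [_ vB] _] := Hv.
    by exists u; split=> //; exists v.
- right; right; left; have /wl Hm := Hin.
  have [/pair_lt [_ tB] _] := Hm.
  by exists 𝟎; split; [mlra | exists (tcode t)].
- by move=> [t1 [/mpr_inj [/(@mnum_inj 1 0)]]].
Qed.

End Truth.

(** * An injection from a dense collection *)

Section Injection.
Variable M : rca_model.
Let HM : models RCA0 M := @rca_modelP M.
Let X0 : sets M := @rca_set M.

Definition tpair (t u : term) : term := TAdd (TMul (TAdd t u) (TAdd t u)) t.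
Definition quadruple : term :=
  tpair (TVar 0) (tpair (TVar 1) (tpair (TVar 2) (TVar 3))).

(** Comprehension stores [P] in the set parameter, so one and the same atom, with the term ⟨y, x, i,
    j⟩, represents every such predicate. The leading 0 in the elements of [X] is the index of the
    set parameter. *)
Lemma code_of_predicate (P : M -> M -> M -> M -> Prop) :
  Def (fun v => P (v 0) (v 1) (v 2) (v 3)) ->
  exists p v (X : sets M), mis_delta0_code p /\
    forall i j, mtrue_sigma2 p ⟨i, j, v⟩ X <-> exists x, forall y, P y x i j.
Proof.
move=> PD.
have [|X HX] := @delta0_comprehension _ HM (fun z =>
  exists y, y < z + 𝟏 /\ exists x, x < z + 𝟏 /\ exists i, i < z + 𝟏 /\
  exists j, j < z + 𝟏 /\ (z = ⟨𝟎, y, x, i, j⟩ /\ P y x i j)).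
  by rewrite /mpr; def.
exists (atom_code M quadruple), 𝟎, X; split; first exact: atom_is_delta0_code.
have E y x i j : mtrue_delta0 (atom_code M quadruple) ⟨y, x, i, j, 𝟎⟩ X <-> P y x i j.
  (* The number parameter 0 equals ⟨0, 0⟩ and so is its own tail: it codes the assignment that is
     constantly 0. *)
  pose v := y .: x .: i .: j .: (fun _ => 𝟎 : M).
  pose s := ⟨y, x, i, j, 𝟎⟩ .: ⟨x, i, j, 𝟎⟩ .: ⟨i, j, 𝟎⟩ .: ⟨j, 𝟎⟩ .: (fun _ => 𝟎 : M).
  have cs : codes_assignment v s.
    by move=> [|[|[|[|k]]]] //=; rewrite mpr00.
  rewrite (true_atom X quadruple cs) HX.
  have -> : eval v quadruple = ⟨y, x, i, j⟩ by [].
  split=> [[y' [_ [x' [_ [i' [_ [j' [_ [K HP]]]]]]]]]|HP].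
    by move: K => /mpr_inj [_ /mpr_inj [-> /mpr_inj [-> /mpr_inj [-> ->]]]].
  have H0 := mpr_ge2 𝟎 ⟨y, x, i, j⟩.
  have H1 := mpr_ge1 y ⟨x, i, j⟩; have H2 := mpr_ge2 y ⟨x, i, j⟩.
  have H3 := mpr_ge1 x ⟨i, j⟩; have H4 := mpr_ge2 x ⟨i, j⟩.
  have H5 := mpr_ge1 i j; have H6 := mpr_ge2 i j.
  exists y; split; first by mlra.
  exists x; split; first by mlra.
  exists i; split; first by mlra.
  by exists j; split; first by mlra.
by move=> i j; split=> -[x Hx]; exists x => y; apply/E.
Qed.

Definition constant_real (c : mrat M) (X : sets M) :=
  mreal X /\ forall i a, mseq_of_set X i a <-> a = c.

Lemma constant_real_exists c : exists X, constant_real c X.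
Proof.
have [|X HX] := @delta0_comprehension _ HM (fun z =>
  exists i, i < z + 𝟏 /\ z = ⟨i, mcode c⟩).
  by rewrite /mpr; def.
have E i a : mseq_of_set X i a <-> a = c.
  rewrite /mseq_of_set HX; split=> [[i' [_ /mpr_inj [_ /mcode_inj]]] //|->].
  by exists i; split=> //; have := mpr_ge1 i (mcode c); mlra.
exists X; split; last exact: E.
split=> [z /HX [i [_ ->]]|]; first by exists i; apply/mrexP; exists c.
split.
  by apply/mis_seqP => i; split=> [|a b /E -> /E ->] //; exists c; apply/E.
by apply: eventually_constant_mcauchy; exists 𝟎, c => n _ a /E.
Qed.

Variables (N : M) (X : sets M).
Hypothesis XN : mfinite_collection N X.
Hypothesis dense : forall Y Z, mreal Y -> mreal Z ->
  mreal_lt (mseq_of_set Y) (mseq_of_set Z) -> exists n, n <= N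
  /\ mreal_le (mseq_of_set Y) (mseq_of_family X n)
  /\ mreal_le (mseq_of_family X n) (mseq_of_set Z).

Let three : M := 𝟏 + 𝟏 + 𝟏.
(** From [K] on, [x_n] stays in the interval (3m, 3m + 3). *)
Let inside m n K := n <= N /\ forall i, K <= i -> forall a,
  mseq_of_family X n i a ->
  (3 * qn m < rval a)%R /\ (rval a < 3 * qn m + 3)%R.

Lemma inside_exists m : exists n K, inside m n K.
Proof.
pose c := MRat (three * m + 𝟏) 𝟎 𝟎; pose d := MRat (three * m + 𝟏 + 𝟏) 𝟎 𝟎.
(* An inequality of reals holds for the entries only eventually and up to an error. With error 1/2,
   the entries stay between 3m + 1/2 and 3m + 5/2, strictly inside the interval required. *)
pose h : mrat M := MRat 𝟏 𝟎 𝟏.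
have Vc : rval c = (3 * qn m + 1)%R by rewrite /rval /c /three /= !qnE; field.
have Vd : rval d = (3 * qn m + 2)%R by rewrite /rval /d /three /= !qnE; field.
have Vh : (rval h * 2 = 1)%R by rewrite /rval /h /= !qnE; field.
have h0 : (0 < rval h)%R by lra.
have [Y [RY HY]] := constant_real_exists c.
have [Z [RZ HZ]] := constant_real_exists d.
have [|n [nN [/mreal_leP /(_ h h0) [K1 H1] /mreal_leP /(_ h h0) [K2 H2]]]] := dense RY RZ.
  split; first by apply: eventually_mreal_le; exists 𝟎 => n _ a b /HY -> /HZ ->; lra.
  move=> [_ /mreal_leP /(_ h h0) [K HK]].
  have := HK K (or_intror erefl) d c (proj2 (HZ K d) erefl) (proj2 (HY K c) erefl).
  by lra.
exists n, (K1 + K2); split=> // i Hi a Ha.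
have i1 : K1 <= i by mlra.
have i2 : K2 <= i by mlra.
have := H1 i i1 c a (proj2 (HY i c) erefl) Ha.
have := H2 i i2 a d Ha (proj2 (HZ i d) erefl).
by lra.
Qed.

Lemma inside_inj m m' n K K' : inside m n K -> inside m' n K' -> m = m'.
Proof.
move=> [nN H] [_ H'].
have [_ /(_ n nN) [/mis_seqP /(_ (K + K')) [[a Ha] _] _]] := XN.
have [|L1 R1] := H (K + K') _ a Ha; first by mlra.
have [|L2 R2] := H' (K + K') _ a Ha; first by mlra.
by case: (mlt_total m m') => [/qn_lt|[//|/qn_lt]] lt; exfalso; lra.
Qed.

(** An arithmetical form of [inside] for w = ⟨n, K⟩: the inequalities for (p - q)/(d + 1) are
    cleared of denominators and subtraction, and the quantifiers over the entries are cut off at [y]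
    to obtain a Delta_0 matrix. *)
Let theta m w y := exists n, n < w + 𝟏 /\ exists K, K < w + 𝟏 /\ (w = ⟨n, K⟩ /\
  (n <= N /\ forall i, i < y + 𝟏 -> forall p, p < y + 𝟏 ->
   forall q, q < y + 𝟏 -> forall d, d < y + 𝟏 ->
   K <= i -> ⟨⟨n, i⟩, ⟨p, q, d⟩⟩ ∈ X ->
   three * m * (d + 𝟏) + q < p /\ p < (three * m + three) * (d + 𝟏) + q)).

Lemma theta_all m w : (forall y, theta m w y) <->
  exists n K, w = ⟨n, K⟩ /\ inside m n K.
Proof.
have E a : (three * m * (mden a + 𝟏) + mneg a < mpos a
    /\ mpos a < (three * m + three) * (mden a + 𝟏) + mneg a) <->
    ((3 * qn m < rval a)%R /\ (rval a < 3 * qn m + 3)%R).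
  rewrite /rval ltr_pdivlMr ?den_gt0 // ltr_pdivrMr ?den_gt0 // /three.
  case: a => p q d /=; split=> -[H1 H2].
    by move/qn_lt: H1 => H1; move/qn_lt: H2 => H2; rewrite !qnE in H1 H2; split; lra.
  have lt (a b : M) : (qn a < qn b)%R -> a < b.
    by move=> H; case: (mlt_total a b) => [//|[Eab|/qn_lt K]]; exfalso;
      [move: H; rewrite Eab ltxx | lra].
  by split; apply: lt; rewrite !qnE; lra.
split=> [H|[n [K [-> [nN H]]]] y].
  have /(pair_bounds (fun n K => _)) [n [K [Ew [nN _]]]] := H 𝟎.
  exists n, K; split=> //; split=> // i Ki [p q d] Ha; apply/E => /=.
  (* The sum is a stage at which the entry with index [i] and components [p], [q], [d] is within the
     cut-off. *)
  have /(pair_bounds (fun n K => _)) [n' [K' [Ew' [_ H']]]] := H (i + p + q + d).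
  move: Ew'; rewrite Ew => /mpr_inj [En EK]; subst n' K'.
  by apply: (H' i _ p _ q _ d _ Ki Ha); mlra.
apply/(pair_bounds (fun n K => _)); exists n, K; split=> //; split=> //.
move=> i _ p _ q _ d _ Ki Ha.
by have /E := H i Ki (MRat p q d) Ha.
Qed.

(** Minimality of [w] is a bounded quantifier in front of a Sigma_1-statement. Guessing the common
    bound [b] as part of [u] makes it Delta_0, so that the whole is Sigma_2 without an appeal to
    bounding; [least_pi1] provides such a [b]. *)
Let Phi y u m n := exists w, w < u + 𝟏 /\ exists b, b < u + 𝟏 /\ (u = ⟨w, b⟩ /\
  (theta m w y /\ (exists K, K < w + 𝟏 /\ w = ⟨n, K⟩) /\
   forall w', w' < w -> exists z, z < b /\ ~ theta m w' z)).

Lemma Phi_all m n : (exists u, forall y, Phi y u m n) <->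
  exists w K b, [/\ w = ⟨n, K⟩, inside m n K &
    forall w', w' < w -> exists z, z < b /\ ~ theta m w' z].
Proof.
split=> [[u H]|[w [K [b [Ew HK Hb]]]]].
  have /(pair_bounds (fun w b => _)) [w [b [Eu [_ [[K [_ EK]] Hb]]]]] := H 𝟎.
  exists w, K, b; split=> //.
  have /theta_all [n' [K' [Ew HK]]] : forall y, theta m w y.
    move=> y; have /(pair_bounds (fun w b => _)) [w' [b' [Eu' [Hw' _]]]] := H y.
    by move: Eu'; rewrite Eu => /mpr_inj [-> _].
  by move: Ew; rewrite EK => /mpr_inj [-> ->].
exists ⟨w, b⟩ => y; apply/(pair_bounds (fun w b => _)); exists w, b; split=> //.
split; first by move: y; apply/theta_all; exists n, K.
split=> //; exists K; split=> //.
by have := mpr_ge2 n K; rewrite -Ew; mlra.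
Qed.

Lemma theta_Def : Def (fun v => theta (v 0) (v 1) (v 2)).
Proof. by rewrite /theta /mpr; def. Qed.

Lemma Phi_Def : Def (fun v => Phi (v 0) (v 1) (v 2) (v 3)).
Proof. by have TD := theta_Def; rewrite /Phi /mpr; def. Qed.

Lemma Phi_injection : minjection_into N (fun m n => exists u, forall y, Phi y u m n).
Proof.
have TD := theta_Def.
split; [|split; [|split]].
- move=> m; have [||w [b [/theta_all [n [K [Ew HK]]] Hb]]] := @least_pi1 M (theta m).
  + by def.
  + have [n [K H]] := inside_exists m.
    by exists ⟨n, K⟩; apply/theta_all; exists n, K.
  + by exists n; apply/Phi_all; exists w, K, b.
- by move=> m n /Phi_all [w [K [b [_ [nN _] _]]]].
- move=> m n n' [/Phi_all [w [K [b [Ew HK Hb]]]] /Phi_all [w' [K' [b' [Ew' HK' Hb']]]]].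
  have all_w : forall y, theta m w y by apply/theta_all; exists n, K.
  have all_w' : forall y, theta m w' y by apply/theta_all; exists n', K'.
  (* If one were smaller, the minimality clause for the other would refute it below its bound. *)
  have E : w = w'.
    case: (mlt_total w w') => [/Hb' [z [_ []]]|[//|/Hb [z [_ []]]]] //.
  by move: Ew; rewrite E Ew' => /mpr_inj [].
- move=> m m' n [/Phi_all [w [K [b [_ HK _]]]] /Phi_all [w' [K' [b' [_ HK' _]]]]].
  exact: inside_inj HK HK'.
Qed.

Lemma not_cardinality : ~ cardinality M.
Proof.
apply; have [p [v [Y [Hp HY]]]] := code_of_predicate Phi_Def.
exists N, p, v, Y; split=> //.
have [H1 [H2 [H3 H4]]] := Phi_injection; split; [|split; [|split]].
- by move=> i; have [j /HY] := H1 i; exists j.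
- by move=> i j /HY; apply: H2.
- by move=> i j k [/HY ? /HY ?]; apply: (H3 i j k).
- by move=> i j k [/HY ? /HY ?]; apply: (H4 i j k).
Qed.

End Injection.

Theorem cardinality_no_dense (M : rca_model) : cardinality M -> no_dense M.
Proof.
move=> card N X XN; apply: NNPP => no; apply: (not_cardinality XN _ card).
move=> Y Z RY RZ ltYZ; apply: NNPP => no1; apply: no; exists Y, Z.
do 3 split=> //; move=> n nN le; apply: no1; by exists n.
Qed.

Theorem proposition2p9 :
  provable RCA0 (FIff no_dense_finite_collection sigma2_cardinality_principle).
Proof.
apply: completeness; first exact: RCA0_subst_closed.
move=> M v V HM; pose M' := RcaModel HM (V 0).
apply/(sat_iff (P := no_dense M) (Q := cardinality M)).
- exact: sat_no_dense.
- exact: sat_cardinality.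
- split; [exact: (@no_dense_cardinality M') | exact: (@cardinality_no_dense M')].
Qed.
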